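(* Let $M$ be a connected semi-simple Frobenius manifold of dimension $3$ with unity $e$ and Euler field $E$, $\mathcal L_E(e)\neq 0$, described in flat coordinates $(t,x,y)$ with $e=\partial_t$ by a potential $F$ of one of the two forms (I) $F=\frac12 t^2y+\frac12 tx^2+f(x,y)$, where $f_{yyy}=f_{xxy}^2-f_{xxx}f_{xyy}$ (case $\langle e,e\rangle=0$), or (II) $F=\frac16 t^3+txy+f(x,y)$, where $f_{xxx}f_{yyy}-f_{xxy}f_{xyy}=1$ (case $\langle e,e\rangle\ne 0$). Let $S\subset M$ be a surface transverse to $e$. Then the booklet 3-web on $S$ is (locally) biholomorphic to the characteristic 3-web of the corresponding solution $f$ of the associativity equation: each point of $S$ has a neighbourhood in $S$ that is mapped by a biholomorphism onto an open subset of the $(x,y)$-plane, taking the leaves of the booklet 3-web to leaves of the characteristic 3-web of $f$.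
   Context: A Frobenius manifold is a complex analytic manifold $M$ equipped with the following analytic objects: a commutative and associative multiplication $\cdot$ on each $T_pM$; a flat non-degenerate symmetric bilinear inner product $\langle\ ,\ \rangle$ on $TM$ with $\langle u\cdot v,w\rangle=\langle u,v\cdot w\rangle$; a unity vector field $e$ ($e\cdot v=v$) with $\nabla e=0$; an Euler vector field $E$ with $\nabla(\nabla E)=0$; such that the flow of $E$ rescales the multiplication and the inner product (their Lie derivatives along $E$ are constant multiples of them), and, with $c(u,v,w):=\langle u\cdot v,w\rangle$, the 4-tensor $(\nabla_z c)(u,v,w)$ is symmetric in all arguments. Here $\nabla$ is the Levi-Civita connection of $\langle\ ,\ \rangle$. It is called semi-simple if $T_pM$ is a semi-simple algebra for all $p$ in some non-empty open set. Potential description. When $\mathcal L_E(e)\neq0$ the Frobenius structure is locally given by a potential $F(t^1,t^2,t^3)$ in flat coordinates: $\eta_{\alpha\beta}=\langle\partial_\alpha,\partial_\beta\rangle=\partial_1\partial_\alpha\partial_\beta F$ is a constant non-degenerate matrix, $\partial_\alpha\cdot\partial_\beta=\sum_{\gamma,i}\eta^{\gamma i}(\partial_i\partial_\alpha\partial_\beta F)\,\partial_\gamma$ is an associative multiplication with unity $e=\partial_1$ (here $(\eta^{\alpha\beta})=(\eta_{\alpha\beta})^{-1}$), and $F$ is quasi-homogeneous, $F(c^{w_1}t^1,c^{w_2}t^2,c^{w_3}t^3)=c^{w_F}F(t^1,t^2,t^3)$, with $E=\sum_i w_it^i\partial_i$. In the claim $(t^1,t^2,t^3)=(t,x,y)$,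 and the displayed equation for $f$ is the associativity equation. Booklet 3-web. At points where the algebra is semi-simple there is locally a frame of idempotents $e_1,e_2,e_3$, $e_i\cdot e_j=\delta_{ij}e_i$, $e=e_1+e_2+e_3$. For a surface $S$ transverse to $e$, the planes spanned by $\{e,e_i\}$ cut three directions on $T_pS$ at each such $p\in S$. The integral curves of the three direction fields form the booklet 3-web on $S$. Characteristic 3-web. For a solution $f$ of the associativity equation, it is the web in the $(x,y)$-plane formed by the characteristic curves of the solution; equivalently, its leaves are the integral curves of the binary cubic differential equation $$dx^3-f_{xxx}\,dx^2dy-2f_{xxy}\,dx\,dy^2-f_{xyy}\,dy^3=0\quad\text{in case (I)},$$ $$f_{xxx}\,dx^3+f_{xxy}\,dx^2dy-f_{xyy}\,dx\,dy^2-f_{yyy}\,dy^3=0\quad\text{in case (II)}.$$ At points where the algebra is not semi-simple some of the web directions coincide (singular points); leaves of both webs are understood as leaves on the set of regular points. *)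

(* Defs.v *)
From HB Require Import structures.
From mathcomp Require Import all_boot all_order all_algebra.
From mathcomp Require Import all_classical all_reals all_analysis.
From mathcomp Require Import complex.

Set Implicit Arguments.
Unset Strict Implicit.
Unset Printing Implicit Defensive.
Import Order.TTheory GRing.Theory Num.Theory numFieldNormedType.Exports.
Local Open Scope classical_set_scope.
Local Open Scope ring_scope.

(* The type annotation lets R[i] carry the topology and the normed space
   structures that the library attaches to every numFieldType. *)
Definition CC (R : realType) : numClosedFieldType := R[i].

Definition cexp (R : realType) (z : CC R) : CC R :=
  let: (x +i* y)%C := (z : R[i]) in
  ((expR x * cos y) +i* (expR x * sin y))%C.

(* On an open set, complex differentiability, complex differentiability of all
   orders, and expansion in power series are the same thing (Cauchy). *)
Section Holomorphic.
Context {R : realType} {V W : normedModType (CC R)}.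

Fixpoint cdiff (n : nat) (U : set V) (f : V -> W) : Prop :=
  (forall p, U p -> differentiable f p) /\
  (if n is m.+1 then forall v : V, cdiff m U (fun p => 'D_v f p) else True).

Definition holomorphic (U : set V) (f : V -> W) : Prop :=
  forall n, cdiff n U f.

End Holomorphic.

Section PartialDerivatives.
Context {R : realType} {n : nat}.
Implicit Types (F : 'rV[CC R]_n -> CC R) (z : 'rV[CC R]_n).

Definition evec (i : 'I_n) : 'rV[CC R]_n := delta_mx ord0 i.

Definition pd (i : 'I_n) F z : CC R := 'D_(evec i) F z.

Definition pd3 (i j k : 'I_n) F z : CC R := pd i (pd j (pd k F)) z.

End PartialDerivatives.

(* [crd] is meaningful on [dom] only, and [pt], its inverse, on
   [img a = crd a @` dom a] only. *)
Record chart (R : realType) (M : topologicalType) (n : nat) := Chart {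
  dom : set M;
  crd : M -> 'rV[CC R]_n;
  pt : 'rV[CC R]_n -> M }.

Section Manifold.
Context {R : realType} {M : topologicalType} {n : nat}.
Local Notation C := (CC R).
Local Notation chart := (chart R M n).
Implicit Types (a b : chart) (A : set chart) (p : M) (i j k l m : 'I_n).

Definition img a : set 'rV[C]_n := crd a @` dom a.

Definition is_chart a : Prop :=
  [/\ open (dom a), open (img a),
      forall p, dom a p -> pt a (crd a p) = p,
      forall p, dom a p -> {for p, continuous (crd a)} &
      forall z, img a z -> {for z, continuous (pt a)}].

Definition transition_holomorphic a b : Prop :=
  holomorphic (crd a @` (dom a `&` dom b)) (crd b \o pt a).

Record complex_manifold A : Prop := {
  mfd_hausdorff : hausdorff_space M;
  mfd_countable : @second_countable M;
  mfd_chart : forall a, A a -> is_chart a;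
  mfd_cover : forall p, exists2 a, A a & dom a p;
  mfd_transition : forall a b, A a -> A b -> transition_holomorphic a b;
  mfd_maximal : forall b, is_chart b ->
    (forall a, A a ->
       transition_holomorphic a b /\ transition_holomorphic b a) -> A b }.

Definition holomorphic_on {W : normedModType C} A (O : set M) (g : M -> W) :=
  forall a, A a -> holomorphic (crd a @` (dom a `&` O)) (g \o pt a).

Definition holomorphic_to {V : normedModType C} A (D : set V) (h : V -> M) :=
  (forall s, D s -> {for s, continuous h}) /\
  (forall a, A a -> holomorphic (D `&` h @^-1` dom a) (crd a \o h)).

(* Tangent vectors at p are row vectors of components in a chart a around p;
   the components in a chart b are obtained by multiplying on the right by
   the following Jacobian matrix. *)
Definition jac a b p : 'M[C]_n :=
  \matrix_(i, j) pd i (fun z => crd b (pt a z) ord0 j) (crd a p).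

Definition mpd a i (h : M -> C) (p : M) : C := pd i (h \o pt a) (crd a p).

(* Components in each chart of the inner product, of the multiplication
   ([fcst a p i j k] is the coefficient of d_k in d_i . d_j), of the unity
   and of the Euler vector field. *)
Record frobenius_data := FrobeniusData {
  fmet : chart -> M -> 'M[C]_n;
  fcst : chart -> M -> 'I_n -> 'I_n -> 'I_n -> C;
  fone : chart -> M -> 'rV[C]_n;
  feul : chart -> M -> 'rV[C]_n }.

Variable X : frobenius_data.

Definition inner a p (u v : 'rV[C]_n) : C :=
  (u *m fmet X a p *m v^T) ord0 ord0.

Definition prodv a p (u v : 'rV[C]_n) : 'rV[C]_n :=
  \row_k \sum_i \sum_j u ord0 i * v ord0 j * fcst X a p i j k.

Definition christoffel a i j k (p : M) : C :=
  2^-1 * \sum_l invmx (fmet X a p) k l *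
    (mpd a i (fun q => fmet X a q j l) p
     + mpd a j (fun q => fmet X a q i l) p
     - mpd a l (fun q => fmet X a q i j) p).

Definition riemann a l k i j (p : M) : C :=
  mpd a i (christoffel a j k l) p - mpd a j (christoffel a i k l) p
  + \sum_m (christoffel a i m l p * christoffel a j k m p
            - christoffel a j m l p * christoffel a i k m p).

(* (nabla_i Y)^k for a vector field with components Y in the chart a *)
Definition nabla_vec a (Y : M -> 'rV[C]_n) i k (p : M) : C :=
  mpd a i (fun q => Y q ord0 k) p
  + \sum_j christoffel a i j k p * Y p ord0 j.

(* (nabla_j nabla Y)^k_i *)
Definition nabla2_vec a (Y : M -> 'rV[C]_n) j i k (p : M) : C :=
  mpd a j (nabla_vec a Y i k) p
  + \sum_m (christoffel a j m k p * nabla_vec a Y i m p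
            - christoffel a j i m p * nabla_vec a Y m k p).

(* c (d_i, d_j, d_k) = <d_i . d_j, d_k> *)
Definition ctensor a i j k (p : M) : C :=
  inner a p (prodv a p (evec i) (evec j)) (evec k).

Definition nabla_c a m i j k (p : M) : C :=
  mpd a m (ctensor a i j k) p
  - \sum_l (christoffel a m i l p * ctensor a l j k p
            + christoffel a m j l p * ctensor a i l k p
            + christoffel a m k l p * ctensor a i j l p).

Definition lie_met a i j (p : M) : C :=
  \sum_k (feul X a p ord0 k * mpd a k (fun q => fmet X a q i j) p
          + fmet X a p k j * mpd a i (fun q => feul X a q ord0 k) p
          + fmet X a p i k * mpd a j (fun q => feul X a q ord0 k) p).

Definition lie_cst a i j k (p : M) : C :=
  \sum_l (feul X a p ord0 l * mpd a l (fun q => fcst X a q i j k) p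
          - fcst X a p i j l * mpd a l (fun q => feul X a q ord0 k) p
          + fcst X a p l j k * mpd a i (fun q => feul X a q ord0 l) p
          + fcst X a p i l k * mpd a j (fun q => feul X a q ord0 l) p).

(* L_E(e) = [E, e] *)
Definition lie_one a k (p : M) : C :=
  \sum_l (feul X a p ord0 l * mpd a l (fun q => fone X a q ord0 k) p
          - fone X a p ord0 l * mpd a l (fun q => feul X a q ord0 k) p).

Definition holomorphic_vector_field A (Y : chart -> M -> 'rV[C]_n) : Prop :=
  (forall a, A a -> holomorphic (img a) (Y a \o pt a)) /\
  (forall a b p, A a -> A b -> dom a p -> dom b p ->
     Y b p = Y a p *m jac a b p).

Record frobenius_manifold A : Prop := {
  frob_mfd : complex_manifold A;
  frob_met_hol : forall a, A a -> forall i j,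
    holomorphic (img a) (fun z => fmet X a (pt a z) i j);
  frob_met_tensor : forall a b p, A a -> A b -> dom a p -> dom b p ->
    fmet X a p = jac a b p *m fmet X b p *m (jac a b p)^T;
  frob_cst_hol : forall a, A a -> forall i j k,
    holomorphic (img a) (fun z => fcst X a (pt a z) i j k);
  frob_cst_tensor : forall a b p, A a -> A b -> dom a p -> dom b p ->
    forall u v, prodv a p u v *m jac a b p =
                prodv b p (u *m jac a b p) (v *m jac a b p);
  frob_one_field : holomorphic_vector_field A (fone X);
  frob_eul_field : holomorphic_vector_field A (feul X);
  frob_prodC : forall a p, A a -> dom a p ->
    forall u v, prodv a p u v = prodv a p v u;
  frob_prodA : forall a p, A a -> dom a p ->
    forall u v w, prodv a p (prodv a p u v) w = prodv a p u (prodv a p v w);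
  frob_prod1 : forall a p, A a -> dom a p ->
    forall v, prodv a p (fone X a p) v = v;
  frob_met_sym : forall a p, A a -> dom a p ->
    forall u v, inner a p u v = inner a p v u;
  frob_met_nondeg : forall a p, A a -> dom a p -> fmet X a p \in unitmx;
  frob_met_flat : forall a p, A a -> dom a p ->
    forall l k i j, riemann a l k i j p = 0;
  frob_met_prod : forall a p, A a -> dom a p -> forall u v w,
    inner a p (prodv a p u v) w = inner a p u (prodv a p v w);
  frob_one_flat : forall a p, A a -> dom a p ->
    forall i k, nabla_vec a (fone X a) i k p = 0;
  frob_eul_flat : forall a p, A a -> dom a p ->
    forall i j k, nabla2_vec a (feul X a) j i k p = 0;
  frob_eul_met : exists d : C, forall a p, A a -> dom a p ->
    forall i j, lie_met a i j p = d * fmet X a p i j;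
  frob_eul_prod : exists d : C, forall a p, A a -> dom a p ->
    forall i j k, lie_cst a i j k p = d * fcst X a p i j k;
  frob_nabla_c_sym : forall a p, A a -> dom a p -> forall m i j k,
    [/\ nabla_c a m i j k p = nabla_c a i m j k p,
        nabla_c a m i j k p = nabla_c a m j i k p &
        nabla_c a m i j k p = nabla_c a m i k j p] }.

(* L_E(e) is a multiple of e by a constant, so it vanishes either everywhere
   or nowhere. *)
Definition lie_one_nonzero A : Prop :=
  exists a p k, [/\ A a, dom a p & lie_one a k p != 0].

(* The rows of T form a frame of idempotents of the tangent algebra at p. *)
Definition idempotent_frame a p (T : 'M[C]_n) : Prop :=
  [/\ T \in unitmx,
      forall i j, prodv a p (row i T) (row j T) =
                  if i == j then row i T else 0 &
      fone X a p = \sum_i row i T].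

Definition semisimple_at A p : Prop :=
  forall a, A a -> dom a p -> exists T, idempotent_frame a p T.

Definition semisimple A : Prop :=
  exists O : set M,
    [/\ open O, O !=set0 & forall p, O p -> semisimple_at A p].

(* [S] is cut out near its point p by the equation g = 0, with dg <> 0 *)
Definition local_equation A (S : set M) p (O : set M) (g : M -> C) : Prop :=
  [/\ open O, O p, holomorphic_on A O g,
      S `&` O = [set q | O q /\ g q = 0] &
      forall a, A a -> dom a p ->
        exists v, 'D_v (g \o pt a) (crd a p) != 0].

(* embedded (not necessarily closed) submanifold of codimension 1 *)
Definition hypersurface A (S : set M) : Prop :=
  forall p, S p -> exists O g, local_equation A S p O g.

Definition tangent A (S : set M) a p (v : 'rV[C]_n) : Prop :=
  exists O g, local_equation A S p O g /\ 'D_v (g \o pt a) (crd a p) = 0.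

Definition transverse_to_one A (S : set M) : Prop :=
  forall a p, A a -> dom a p -> S p -> ~ tangent A S a p (fone X a p).

Definition booklet_direction A (S : set M) a p (v : 'rV[C]_n) : Prop :=
  tangent A S a p v /\
  exists T i, idempotent_frame a p T /\
    exists al be : C, v = al *: fone X a p + be *: row i T.

(* A connected integral curve of the web, as a set. A frame of idempotents at
   p is unique up to order and, at a point of a transverse surface where there
   is one, the directions are pairwise distinct; the velocity being continuous
   and nonzero, the curve follows a single direction field. *)
Definition booklet_leaf A (S : set M) (L : set M) : Prop :=
  L `<=` S /\
  exists (D : set C) (h : C -> M),
    [/\ open D, connected D, D !=set0, holomorphic_to A D h & L = h @` D] /\
    forall s a, D s -> A a -> dom a (h s) ->
      derive1 (crd a \o h) s != 0 /\
      booklet_direction A S a (h s) (derive1 (crd a \o h) s).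

(* A map defined on a locally closed submanifold N is holomorphic when it
   extends locally to a holomorphic map on an open subset of the manifold. *)
Definition biholomorphism {d : nat} A (N : set M) (V : set 'rV[C]_d)
    (Phi : M -> 'rV[C]_d) (Psi : 'rV[C]_d -> M) : Prop :=
  [/\ open V, Phi @` N = V, forall q, N q -> Psi (Phi q) = q,
      forall q, N q -> exists (O : set M) (G : M -> 'rV[C]_d),
        [/\ open O, O q, holomorphic_on A O G &
            forall r, N r -> O r -> Phi r = G r] &
      holomorphic_to A V Psi].

End Manifold.

Arguments frobenius_data : clear implicits.

Section Potential.
Context {R : realType} {M : topologicalType}.
Local Notation C := (CC R).
Implicit Types (F : 'rV[C]_3 -> C) (a : chart R M 3).

(* Quasi-homogeneity with c = exp s near 1: the weights are complex and the
   domain U need not be invariant under the scaling. *)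
Definition quasi_homogeneous (w : 'I_3 -> C) (wF : C) (U : set 'rV[C]_3) F :=
  forall z, U z -> \forall s \near (0 : C),
    F (\row_i (cexp (w i * s) * z ord0 i)) = cexp (wF * s) * F z.

(* The coordinates of a are flat, with e = d_0, and the structure is given
   there by the potential F. *)
Definition flat_potential (X : frobenius_data R M 3) a F : Prop :=
  [/\ holomorphic (img a) F,
      exists eta : 'M[C]_3, forall p, dom a p ->
        fmet X a p = eta /\
        forall i j, eta i j = pd3 ord0 i j F (crd a p),
      forall p, dom a p -> forall i j k,
        fcst X a p i j k =
        \sum_l invmx (fmet X a p) k l * pd3 l i j F (crd a p),
      forall p, dom a p -> fone X a p = evec ord0 &
      exists w wF, quasi_homogeneous w wF (img a) F /\
        forall p, dom a p ->
          feul X a p = \row_i (w i * crd a p ord0 i)].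

End Potential.

Section CharacteristicWeb.
Context {R : realType}.
Local Notation C := (CC R).
Implicit Types (f : 'rV[C]_2 -> C) (z v : 'rV[C]_2).

(* (t, x, y) |-> (x, y) *)
Definition xy (q : 'rV[C]_3) : 'rV[C]_2 := \row_j q ord0 (lift ord0 j).

Local Notation X := (ord0 : 'I_2).
Local Notation Y := (ord_max : 'I_2).

Definition fxxx f := pd3 X X X f.
Definition fxxy f := pd3 X X Y f.
Definition fxyy f := pd3 X Y Y f.
Definition fyyy f := pd3 Y Y Y f.

Inductive potential_form := FormI | FormII.

Definition potential_of (c : potential_form) f (q : 'rV[C]_3) : C :=
  let t := q ord0 ord0 in
  let x := xy q ord0 X in
  let y := xy q ord0 Y in
  match c with
  | FormI => 2^-1 * t ^+ 2 * y + 2^-1 * t * x ^+ 2 + f (xy q)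
  | FormII => 6^-1 * t ^+ 3 + t * x * y + f (xy q)
  end.

Definition associativity_equation (c : potential_form) f z : Prop :=
  match c with
  | FormI => fyyy f z = fxxy f z ^+ 2 - fxxx f z * fxyy f z
  | FormII => fxxx f z * fyyy f z - fxxy f z * fxyy f z = 1
  end.

Definition char_cubic (c : potential_form) f z v : C :=
  let dx := v ord0 X in
  let dy := v ord0 Y in
  match c with
  | FormI => dx ^+ 3 - fxxx f z * dx ^+ 2 * dy
             - 2 * fxxy f z * dx * dy ^+ 2 - fxyy f z * dy ^+ 3
  | FormII => fxxx f z * dx ^+ 3 + fxxy f z * dx ^+ 2 * dy
              - fxyy f z * dx * dy ^+ 2 - fyyy f z * dy ^+ 3
  end.

(* the cubic form is nonzero and has three distinct root directions *)
Definition char_regular (c : potential_form) f z : Prop :=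
  (exists v, char_cubic c f z v != 0) /\
  exists u : 'I_3 -> 'rV[C]_2,
    (forall i, char_cubic c f z (u i) = 0) /\
    (forall i j, i != j ->
       u i ord0 X * u j ord0 Y - u i ord0 Y * u j ord0 X != 0).

Definition char_leaf (c : potential_form) (U : set 'rV[C]_2) f
    (L : set 'rV[C]_2) : Prop :=
  L `<=` U /\
  exists (D : set C) (h : C -> 'rV[C]_2),
    [/\ open D, connected D, D !=set0, holomorphic D h & L = h @` D] /\
    forall s, D s ->
      [/\ derive1 h s != 0, char_regular c f (h s) &
          char_cubic c f (h s) (derive1 h s) = 0].

End CharacteristicWeb.

(* Main.v *)
From HB Require Import structures.
Require Import Defs.
From mathcomp Require Import all_boot all_order all_algebra.
From mathcomp Require Import all_classical all_reals all_analysis.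
From mathcomp Require Import complex ring.
Import Order.TTheory GRing.Theory Num.Theory numFieldNormedType.Exports.
Local Open Scope classical_set_scope.
Local Open Scope ring_scope.
Set Implicit Arguments.
Unset Strict Implicit.
Unset Printing Implicit Defensive.

(** The two webs are the same family of curves seen in S and in the (x, y)-plane.
In the flat coordinates (t, x, y) the unity is d_t, so that a surface S
transverse to it is locally a graph t = tau(x, y) ([implicit_function]), and
Phi = (x, y) restricted to S is a biholomorphism onto an open set, with inverse
z |-> (tau z, z).  The plane spanned by e and an idempotent e_i is the preimage
of the line spanned by the projection of e_i, so that Phi sends the booklet
directions to the projections of the e_i, and it remains to recognise these as
the root lines of the characteristic cubic.

The link is [square_cubic_prodv]: at a point of the algebra, the cubic at the
projection of a vector v is the determinant of the projections of v and of
v . v, i.e. the determinant of (e, v, v . v).  This is a computation with the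
structure constants read off the potential.  It vanishes exactly when e, v and
v . v are linearly dependent, which has two consequences.  If there is a frame
of idempotents, with v = sum_i l_i e_i, the determinant is a multiple of the
Vandermonde product of the l_i, so that its roots are the vectors a e + b e_i
([frame_cubic], [cubic_root_frame]); moreover the three projections are pairwise
independent ([frame_det2]) and the cubic is not zero ([char_cubic_neq0]), so that
the characteristic web is regular there.
Conversely a cubic with three distinct root lines forces the algebra to be
semi-simple, and the frame is built from the roots
([idempotent_frame_of_roots]).

A curve on S is an integral curve of one web iff its projection is one of the
other, because a vector tangent to S is determined by its projection
([booklet_leaf_projects], [char_leaf_lifts]).  The first inclusion uses that a
nonzero tangent vector of S cannot be a multiple of e; the second that the lift
of a curve stays in S, hence is tangent to it.

The symmetry of the third derivatives of the potential comes from the algebra: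
commutativity and invariance of the inner product ([potential_swap],
[potential_rot]).  The implicit function is the fixed point of a Newton map,
which is a contraction by a complex mean value inequality; its higher
differentiability follows from the formula for its derivative. *)

(** * Functions differentiable to a finite order *)

Section DiffEstimates.
Context {R : realType} {V W : normedModType (CC R)}.
Local Notation C := (CC R).

Lemma diff_remainder (f : V -> W) x : differentiable f x ->
  forall e : C, 0 < e -> \forall h \near 0, `|f (h + x) - (f x + 'd f x h)| <= e * `|h|.
Proof. by move=> df e e0; have /eqaddoP /(_ _ e0) := diff_locally df. Qed.

(** The differential of an implicitly defined function is known beforehand; this
is the criterion by which it is recognised. *)
Lemma remainder_diff (f : V -> W) x (L : {linear V -> W}) : continuous L ->
  (forall e : C, 0 < e -> \forall h \near 0, `|f (h + x) - (f x + L h)| <= e * `|h|) ->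
  differentiable f x.
Proof.
move=> cL H.
have fL : f \o shift x = cst (f x) + L +o_ 0 id by apply/eqaddoP => e e0; exact: H.
by apply/diff_locallyP; rewrite (@diff_unique _ _ _ f L x cL fL); split.
Qed.

Lemma diff_lipschitz (f : V -> W) x : differentiable f x ->
  exists2 k : C, 0 < k & \forall h \near 0, `|f (h + x) - f x| <= k * `|h|.
Proof.
move=> df; have [k k0 kP] := linear_lipschitz (diff_continuous df).
exists (1 + k); first by rewrite addr_gt0.
have := diff_remainder df ltr01; apply: filterS => h hP.
have -> : f (h + x) - f x = (f (h + x) - (f x + 'd f x h)) + 'd f x h.
  by rewrite opprD addrA subrK.
by rewrite (le_trans (ler_normD _ _)) // mulrDl lerD.
Qed.

End DiffEstimates.

Section HolomorphicCalculus.
Context {R : realType}.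
Local Notation C := (CC R).
Implicit Types (V W : normedModType C).

Lemma cdiff_diff {V W} n (U : set V) (f : V -> W) p :
  cdiff n U f -> U p -> differentiable f p.
Proof. by case: n => [|n] [+ _] Up; apply. Qed.

Lemma cdiffS {V W} n (U : set V) (f : V -> W) : cdiff n.+1 U f -> cdiff n U f.
Proof.
elim: n f => [|n IH] f [df ddf]; split => // v.
exact/IH/ddf.
Qed.

Lemma cdiff_derive {V W} n (U : set V) (f : V -> W) v :
  cdiff n.+1 U f -> cdiff n U (fun p => 'D_v f p).
Proof. by case=> _; apply. Qed.

Lemma cdiff_sub {V W} n (U U' : set V) (f : V -> W) :
  U' `<=` U -> cdiff n U f -> cdiff n U' f.
Proof.
move=> sU; elim: n f => [|n IH] f [df ddf]; split => //.
- by move=> p /sU; apply: df.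
- by move=> p /sU; apply: df.
- by move=> v; apply/IH/ddf.
Qed.

Lemma near_eq_differentiable {V W} (f g : V -> W) (p : V) :
  {near p, f =1 g} -> differentiable f p -> differentiable g p.
Proof.
move=> fg df; apply: (remainder_diff (diff_continuous df)) => e e0.
have := diff_remainder df e0.
have : \forall y \near (0 : V), f (y + p) = g (y + p).
  by move: fg; rewrite (near_shift 0 p) subr0.
by apply: filterS2 => y ->; rewrite (nbhs_singleton fg).
Qed.

(** Each derivative at p depends on the values near p, hence the openness of U. *)
Lemma cdiff_eq {V W} n (U : set V) (f g : V -> W) : open U ->
  (forall p, U p -> f p = g p) -> cdiff n U f -> cdiff n U g.
Proof.
move=> oU; elim: n f g => [|n IH] f g fg [df ddf].
  split => // p Up; apply: near_eq_differentiable (df p Up).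
  by near=> q; apply: fg; near: q; apply: open_nbhs_nbhs.
split.
  move=> p Up; apply: near_eq_differentiable (df p Up).
  by near=> q; apply: fg; near: q; apply: open_nbhs_nbhs.
move=> v; apply: IH (ddf v) => p Up; apply: near_eq_derive.
by near=> q; apply: fg; near: q; apply: open_nbhs_nbhs.
Unshelve. all: by end_near. Qed.

Lemma cdiff_cst {V W} n (U : set V) (c : W) : cdiff n U (cst c).
Proof.
elim: n c => [|n IH] c; split.
- by move=> p _; apply: differentiable_cst.
- by [].
- by move=> p _; apply: differentiable_cst.
move=> v; rewrite (_ : (fun p => _) = cst 0); first exact: IH.
by apply/funext => p; rewrite derive_cst.
Qed.

Lemma cdiff_id {V} n (U : set V) : cdiff n U (id : V -> V).
Proof.
case: n => [|n]; split => // v; rewrite (_ : (fun p => _) = cst v).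
  exact: cdiff_cst.
by apply/funext => p; rewrite derive_id.
Qed.

Lemma derive_linE {V W W'} (l : {linear W -> W'}) (f : V -> W) p v :
  continuous l -> differentiable f p -> 'D_v (l \o f) p = l ('D_v f p).
Proof.
move=> cl df; have dl : differentiable l (f p) by apply: linear_differentiable.
rewrite (deriveE _ (differentiable_comp df dl)) (deriveE _ df).
by rewrite (diff_comp df dl) /= (diff_lin _ cl).
Qed.

Lemma cdiff_lin {V W W'} n (U : set V) (l : {linear W -> W'}) (f : V -> W) :
  open U -> continuous l -> cdiff n U f -> cdiff n U (l \o f).
Proof.
move=> oU cl; elim: n f => [|n IH] f [df ddf]; split.
- by move=> p Up; apply: differentiable_comp; [exact: df|exact: linear_differentiable].
- by [].
- by move=> p Up; apply: differentiable_comp; [exact: df|exact: linear_differentiable].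
- move=> v; apply: cdiff_eq (IH _ (ddf v)) => // p Up /=.
  by rewrite derive_linE //; apply: df.
Qed.

Lemma cdiffD {V W} n (U : set V) (f g : V -> W) : open U ->
  cdiff n U f -> cdiff n U g -> cdiff n U (f + g).
Proof.
move=> oU; elim: n f g => [|n IH] f g [df ddf] [dg ddg]; split.
- by move=> p Up; apply: differentiableD; [exact: df|exact: dg].
- by [].
- by move=> p Up; apply: differentiableD; [exact: df|exact: dg].
- move=> v; apply: cdiff_eq (IH _ _ (ddf v) (ddg v)) => // p Up.
  by rewrite deriveD//; apply: diff_derivable; [exact: df|exact: dg].
Qed.

Lemma cdiff_sum {V W} n m (U : set V) (f : 'I_m -> V -> W) : open U ->
  (forall i, cdiff n U (f i)) -> cdiff n U (\sum_i f i).
Proof.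
move=> oU df; elim/big_rec: _ => [|i g _ IH]; first exact: cdiff_cst.
exact: cdiffD.
Qed.

Lemma cdiffM {V} n (U : set V) (f g : V -> C) : open U ->
  cdiff n U f -> cdiff n U g -> cdiff n U (f * g).
Proof.
move=> oU; elim: n f g => [|n IH] f g df dg; split.
- by move=> p Up; apply: differentiableM; apply: cdiff_diff Up; eassumption.
- by [].
- by move=> p Up; apply: differentiableM; apply: cdiff_diff Up; eassumption.
move=> v.
apply: (@cdiff_eq _ _ _ _ (f * (fun p => 'D_v g p) + g * (fun p => 'D_v f p))) => //.
  move=> p Up; rewrite deriveM //; apply: diff_derivable.
    exact: cdiff_diff df Up.
  exact: cdiff_diff dg Up.
apply: cdiffD => //; apply: IH.
- exact: cdiffS.
- exact: cdiff_derive.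
- exact: cdiffS.
- exact: cdiff_derive.
Qed.

Lemma cdiffV {V} n (U : set V) (f : V -> C) : open U ->
  (forall p, U p -> f p != 0) -> cdiff n U f -> cdiff n U (fun p => (f p)^-1).
Proof.
move=> oU f0; elim: n => [|n IH] df; split.
- by move=> p Up; apply: differentiableV; [apply: cdiff_diff df Up|exact: f0].
- by [].
- by move=> p Up; apply: differentiableV; [apply: cdiff_diff df Up|exact: f0].
move=> v; have dV := IH (cdiffS df).
apply: (@cdiff_eq _ _ _ _ (cst (-1) * (((fun p => (f p)^-1) * (fun p => (f p)^-1)) * (fun p => 'D_v f p)))) => //.
  move=> p Up; rewrite deriveV ?f0 //; last first.
    by apply: diff_derivable; exact: cdiff_diff df Up.
  by rewrite !fctE mulN1r scaleNr -exprVn expr2.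
apply: cdiffM => //; first exact: cdiff_cst.
apply: cdiffM => //; first exact: cdiffM.
exact: cdiff_derive.
Qed.

Lemma derive_compE {V W W'} (g : V -> W) (f : W -> W') p v :
  differentiable g p -> differentiable f (g p) ->
  'D_v (f \o g) p = 'D_('D_v g p) f (g p).
Proof.
move=> dg df; rewrite (deriveE _ (differentiable_comp dg df)) (diff_comp dg df).
by rewrite (deriveE _ df) (deriveE _ dg).
Qed.

Lemma derive_pdE {n} {W} (f : 'rV[C]_n -> W) q w : differentiable f q ->
  'D_w f q = \sum_j w ord0 j *: 'D_(evec j) f q.
Proof.
move=> df; rewrite [in LHS](row_sum_delta w) (deriveE _ df) linear_sum.
by apply: eq_bigr => j _; rewrite linearZ (deriveE _ df).
Qed.

Definition rV_coord {n} (j : 'I_n) (q : 'rV[C]_n) : C := q ord0 j.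

Lemma rV_coord_is_linear n (j : 'I_n) : linear (@rV_coord n j).
Proof. by move=> a u v; rewrite /rV_coord !mxE. Qed.

HB.instance Definition _ n (j : 'I_n) :=
  GRing.isLinear.Build C 'rV[C]_n C _ (@rV_coord n j) (@rV_coord_is_linear n j).

Lemma continuous_coord n (j : 'I_n) : continuous (@rV_coord n j).
Proof. exact: coord_continuous. Qed.

Lemma cdiffZl {V W} n (U : set V) (f : V -> C) (w : W) : open U ->
  cdiff n U f -> cdiff n U (fun p => f p *: w).
Proof.
move=> oU; elim: n f => [|n IH] f [df ddf]; split.
- by move=> p Up; apply: differentiableZl; exact: df.
- by [].
- by move=> p Up; apply: differentiableZl; exact: df.
move=> v; apply: cdiff_eq (IH _ (ddf v)) => // p Up.
have dfp := df p Up.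
by rewrite (deriveE _ (differentiableZl w dfp)) (diffZl w dfp) (deriveE _ dfp).
Qed.

Lemma cdiff_rV {V} n m (U : set V) (g : V -> 'rV[C]_m) : open U ->
  (forall j, cdiff n U (fun p => g p ord0 j)) -> cdiff n U g.
Proof.
move=> oU dg; apply: (@cdiff_eq _ _ _ _ (\sum_j (fun p => g p ord0 j *: evec j))) => //.
  by move=> p Up; rewrite fct_sumE [RHS]row_sum_delta.
by apply: cdiff_sum => // j; apply: cdiffZl.
Qed.

Lemma cdiff_coord {V} n m (U : set V) (g : V -> 'rV[C]_m) j : open U ->
  cdiff n U g -> cdiff n U (fun p => g p ord0 j).
Proof.
move=> oU dg.
exact: (@cdiff_lin _ _ _ n U (@rV_coord m j) g oU (@continuous_coord m j) dg).
Qed.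

Lemma derive_coord {V} m (g : V -> 'rV[C]_m) j p v : differentiable g p ->
  ('D_v g p) ord0 j = 'D_v (fun p => g p ord0 j) p.
Proof.
move=> dg.
by have := derive_linE v (@continuous_coord m j) dg => ->.
Qed.

(** The derivative of f \o g is the sum over j of the products of the j-th
partial derivative of f, composed with g, by the j-th coordinate of the
derivative of g.  All factors have one order of differentiability less, which
makes the induction work; the finite basis of the intermediate space is what
turns the derivative of f in a varying direction into finitely many functions. *)
Lemma cdiff_comp_scalar {V} n m (U : set V) (U' : set 'rV[C]_m)
    (g : V -> 'rV[C]_m) (f : 'rV[C]_m -> C) :
  open U -> open U' -> (forall p, U p -> U' (g p)) ->
  cdiff n U g -> cdiff n U' f -> cdiff n U (f \o g).
Proof.
move=> oU oU' UU'; elim: n f => [|n IH] f dg df; split.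
- move=> p Up; apply: differentiable_comp; first exact: cdiff_diff dg Up.
  by apply: cdiff_diff df _; exact: UU'.
- by [].
- move=> p Up; apply: differentiable_comp; first exact: cdiff_diff dg Up.
  by apply: cdiff_diff df _; exact: UU'.
move=> v.
apply: (@cdiff_eq _ _ _ _ (\sum_j ((fun p => ('D_v g p) ord0 j) * ((fun q => 'D_(evec j) f q) \o g)))) => //.
  move=> p Up.
  have dgp := cdiff_diff dg Up; have dfp := cdiff_diff df (UU' _ Up).
  by rewrite derive_compE // derive_pdE // fct_sumE.
apply: cdiff_sum => // j; apply: cdiffM => //.
  by apply: cdiff_coord => //; exact: cdiff_derive.
apply: IH; first exact: cdiffS.
exact: cdiff_derive.
Qed.

Lemma cdiff_comp {V} n m k (U : set V) (U' : set 'rV[C]_m)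
    (g : V -> 'rV[C]_m) (f : 'rV[C]_m -> 'rV[C]_k) :
  open U -> open U' -> (forall p, U p -> U' (g p)) ->
  cdiff n U g -> cdiff n U' f -> cdiff n U (f \o g).
Proof.
move=> oU oU' UU' dg df; apply: cdiff_rV => // j.
exact: (cdiff_comp_scalar oU oU' UU' dg (cdiff_coord j oU' df)).
Qed.

End HolomorphicCalculus.

(** * Mean value inequality and fixed points in the complex plane *)

Section ComplexAnalysis.
Context {R : realType}.
Local Notation C := (CC R).

Local Notation Re := (@complex.Re R : C -> R).
Local Notation rc := (real_complex R : R -> C).

Lemma norm_rc (x : R) : `|rc x| = rc `|x|.
Proof. by rewrite (normc_def (rc x)) /= expr0n addr0 sqrtr_sqr. Qed.

Lemma pos_rc (e : C) : 0 < e -> exists2 d : R, 0 < d & e = rc d.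
Proof.
move=> e0; have := gtr0_real e0 => /complex_realP[d ed]; exists d => //.
by move: e0; rewrite ed (ltcR 0 d).
Qed.

Lemma continuous_Re : continuous Re.
Proof.
move=> x; apply/(@cvgrPdist_lt R R C (nbhs x) _ Re (Re x)) => e e0.
have e0' : (0 : C) < rc e by rewrite (ltcR 0 e).
have := @cvg_id C (nbhs x); move/cvgrPdist_lt => /(_ _ e0').
apply: filterS => y xy; rewrite -(ltcR _ e); apply: le_lt_trans xy.
by have := normc_ge_Re (x - y); rewrite raddfB.
Qed.

Lemma continuous_rc : continuous rc.
Proof.
move=> x; apply/(@cvgrPdist_lt C C R (nbhs x) _ rc (rc x)) => e /pos_rc [d d0 ->].
have := @cvg_id R (nbhs x); move/cvgrPdist_lt => /(_ _ d0).
apply: filterS => y xy; rewrite -rmorphB /= norm_rc.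
by rewrite (ltcR _ d).
Qed.

Lemma rc_dnbhs0 : rc h @[h --> (0 : R)^'] --> (0 : C)^'.
Proof.
move=> A A0.
have : \forall h \near (0 : R), rc h != 0 -> A (rc h).
  by have := @continuous_rc 0 _ A0.
by apply: filterS => h Ah h0; apply: Ah; rewrite (inj_eq (@complexI R) h 0).
Qed.

Lemma Re_rcM (r : R) (x : C) : Re (rc r * x) = r * Re x.
Proof. by case: x => a b /=; rewrite mul0r subr0. Qed.

(** A complex-valued function has no mean value theorem, but its real part in a
fixed direction does: with u = phi w - phi z, the real function
s |-> Re (conj u * phi (z + s (w - z))) increases by |u|^2 on [0, 1], while its
derivative is at most |u| M |w - z|. *)
Lemma mean_value_complex (phi : C -> C) (z w M : C) :
  (forall s : R, 0 <= s <= 1 -> let p := z + rc s * (w - z) in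
     differentiable phi p /\ `|'D_1 phi p| <= M) ->
  `|phi w - phi z| <= M * `|w - z|.
Proof.
move=> H; set u := phi w - phi z.
have M0 : 0 <= M.
  by have [|_] := H 0; rewrite ?lexx ?ler01//; apply: le_trans.
have [->|u0] := eqVneq u 0; first by rewrite normr0 mulr_ge0.
pose d := w - z.
pose psi (s : Real.sort R) := Re (u^* * phi (z + rc s * d)).
pose dpsi (s : Real.sort R) := Re (u^* * (d * 'D_1 phi (z + rc s * d))).
have dP (s : R) : 0 <= s <= 1 -> is_derive s 1 psi (dpsi s).
  move=> s01; have [df _] := H s s01; set p := z + _ in df.
  have cq : (fun k : C => k^-1 *: (phi (k *: d + p) - phi p)) @ (0 : C)^' --> d * 'D_1 phi p.
    have -> : d * 'D_1 phi p = 'D_d phi p.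
      by rewrite !(deriveE _ df) -{2}(mulr1 d) -[d * 1]/(d *: 1) linearZ.
    exact: diff_derivable df.
  have cp : (fun h : R => h^-1 *: (psi (h *: 1 + s) - psi s)) @ (0 : R)^' --> dpsi s.
    have c2 := cvg_comp _ _ rc_dnbhs0 cq.
    have cm : {for d * 'D_1 phi p, continuous (fun y : C => Re (u^* * y))}.
      apply: continuous_comp; last exact: continuous_Re.
      exact: (@cvgMr C C (nbhs (d * 'D_1 phi p)) _ id u^* _ cvg_id).
    have cc := continuous_cvg (dnbhs_filter 0) cm c2.
    apply: (cvg_trans _ cc); apply: near_eq_cvg; near=> h.
    rewrite /= /psi.
    have -> : z + rc (h *: 1 + s) * d = rc h *: d + p.
      rewrite -[h *: 1]/(h * 1) mulr1 rmorphD /= mulrDl addrCA.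
      by rewrite /p -/d -[rc h *: d]/(rc h * d).
    rewrite /GRing.scale /= -fmorphV mulrCA Re_rcM mulrBr raddfB.
    by [].
  split; first by apply/cvg_ex; exists (dpsi s).
  exact: cvg_lim cp.
have [c c01] := @MVT_segment R psi dpsi 0 1 ler01
  (fun x x01 => dP x ltac:(by move: x01; rewrite in_itv => /andP[/ltW-> /ltW->]))
  ltac:(by apply: derivable_within_continuous => x; rewrite in_itv => /dP[]).
rewrite subr0 mulr1 => E.
have Eu : `|u| ^+ 2 = rc (dpsi c).
  have <- : psi 1 - psi 0 = dpsi c by [].
  rewrite /psi rmorph1 rmorph0 mul0r addr0 mul1r /d subrKC -raddfB -mulrBr -/u.
  by rewrite mulrC -normCK; have := add_Re2_Im2 u => <-.
have [_ Mc] := H c c01.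
have : `|u| ^+ 2 <= `|u| * (M * `|w - z|).
  rewrite Eu.
  apply: le_trans (_ : rc `|dpsi c| <= _).
    by rewrite (lecR (dpsi c)) ler_norm.
  apply: le_trans (normc_ge_Re _) _.
  by rewrite !normrM norm_conjC ler_wpM2l // mulrC ler_wpM2r.
by rewrite expr2 ler_pM2l ?normr_gt0.
Unshelve. all: by end_near. Qed.

End ComplexAnalysis.

Section FixedPoint.
Context {R : realType}.
Local Notation C := (CC R).
Local Notation Re := (@complex.Re R : C -> R).
Local Notation Im := (@complex.Im R : C -> R).
Local Notation rc := (real_complex R : R -> C).

Lemma rc_Re_norm (z : C) : rc (Re `|z|) = `|z|.
Proof. by apply: RRe_real; exact: normr_real. Qed.

(** The disc is closed in a square with sides parallel to the axes, which is the
continuous image of a product of two segments. *)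
Lemma compact_disc (t0 : C) (r : C) : compact [set t : C | `|t - t0| <= r].
Proof.
have [|r0] := boolP (0 <= r); last first.
  rewrite (_ : mkset _ = set0); first exact: compact0.
  apply/seteqP; split => // t /= tr; case/negP: r0; exact: le_trans tr.
move=> /ger0_real/complex_realP[d rd].
pose m (p : R * R) : C := rc p.1 + 'i%C * rc p.2.
have cm : continuous m.
  move=> p.
  have c1 : {for p, continuous (fun p : R * R => rc p.1)}.
    by apply: (@continuous_comp _ _ _ fst rc); [exact: cvg_fst | exact: continuous_rc].
  have c2 : {for p, continuous (fun p : R * R => rc p.2)}.
    by apply: (@continuous_comp _ _ _ snd rc); [exact: cvg_snd | exact: continuous_rc].
  have c3 : {for p, continuous (fun p : R * R => 'i%C * rc p.2 : C)}.
    exact: (@cvgMr C (R * R)%type (nbhs p) _ (fun p => rc p.2) 'i%C _ c2).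
  exact: (@cvgD C C (R * R)%type (nbhs p) _ (fun p => rc p.1) (fun p => 'i%C * rc p.2) _ _ c1 c3).
pose B := `[Re t0 - d, Re t0 + d] `*` `[Im t0 - d, Im t0 + d].
have cB : compact (m @` B).
  apply: continuous_compact; first exact: continuous_subspaceT.
  by apply: compact_setX; exact: segment_compact.
apply: subclosed_compact cB _.
  rewrite (_ : mkset _ = (fun t : C => Re `|t - t0|) @^-1` [set x | x <= d]).
    apply: closed_comp; last exact: closed_le.
    move=> t _.
    have cn : {for t, continuous (fun t : C => `|t - t0| : C)}.
      have cs : (fun t : C => t - t0) x @[x --> t] --> t - t0.
        exact: (@cvgB C C C (nbhs t) _ id (cst t0) t t0 cvg_id (cvg_cst _)).
      exact: (cvg_norm cs).
    exact: (@continuous_comp _ _ _ (fun t : C => `|t - t0| : C) Re t cn (@continuous_Re R _)).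
  by apply/seteqP; split => t /=; rewrite -(lecR _ d) rc_Re_norm rd.
move=> t /= tr; exists (Re t, Im t); last by rewrite /m /= -complexE.
have rtd (z : C) : `|z| <= r -> `|Re z| <= d.
  by rewrite rd => zd; rewrite -(lecR _ d); apply: le_trans zd; exact: normc_ge_Re.
have itd (z : C) : `|z| <= r -> `|Im z| <= d.
  move=> zr; have -> : Im z = - Re (z * 'i%C) by rewrite ReiNIm opprK.
  by rewrite normrN; apply: rtd; rewrite normrM (normc_def 'i%C) /= expr0n add0r
    expr1n sqrtr1 mulr1.
split; rewrite /= in_itv /= -ler_distl -raddfB; [exact: rtd|exact: itd].
Qed.

(** The displacement |t - N t| attains its minimum on the compact disc; at a
minimiser c the displacement of N c is at most half that of c, so both vanish. *)
Lemma contraction_disc (N : C -> C) (t0 r : C) : 0 <= r ->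
  (forall t, `|t - t0| <= r -> `|N t - t0| <= r) ->
  (forall s t, `|s - t0| <= r -> `|t - t0| <= r ->
     `|N s - N t| <= 2^-1 * `|s - t|) ->
  exists2 t, `|t - t0| <= r & N t = t.
Proof.
move=> r0 NK Nc; pose K := [set t : C | `|t - t0| <= r].
pose psi (t : C) := Re `|t - N t|.
have K0 : K !=set0 by exists t0; rewrite /K /= subrr normr0.
have cpsi : {within K, continuous psi}.
  apply/subspace_continuousP => x Kx.
  apply/(@cvgrPdist_lt R R C _ _ psi (psi x)) => e e0.
  have e1 : (0 : C) < rc (e / 2) by rewrite (ltcR 0 (e / 2)) divr_gt0.
  have := @cvg_id C (nbhs x); move/cvgrPdist_lt => /(_ _ e1).
  rewrite !near_simpl /within /=; apply: filterS => y xy Ky.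
  rewrite -(ltcR _ e) /psi -raddfB.
  apply: (le_lt_trans (normc_ge_Re _)).
  apply: (le_lt_trans (ler_dist_dist _ _)).
  have -> : x - N x - (y - N y) = (x - y) - (N x - N y) by ring.
  apply: (le_lt_trans (ler_normB _ _)).
  have -> : rc e = rc (e / 2) + rc (e / 2) by rewrite -rmorphD /= -splitr.
  apply: ltr_leD => //.
  apply: le_trans (Nc _ _ Kx Ky) _.
  by rewrite -[leRHS]mul1r; apply: ler_pM => //; [rewrite invf_le1 ?ler1n|exact: ltW].
have [c cK cmin] := compact_EVT_min K0 (@compact_disc t0 r) cpsi.
rewrite inE in cK; exists c => //.
apply/eqP; rewrite eq_sym -subr_eq0 -normr_le0.
have NcK : N c \in K by rewrite inE; apply: NK.
have := cmin _ NcK; rewrite -(lecR _ (psi (N c))) !rc_Re_norm => le1.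
have := le_trans le1 (Nc _ _ cK (NK _ cK)) => le2.
have : `|c - N c| * 2^-1 <= 0.
  rewrite -(lerD2l (2^-1 * `|c - N c|)) addr0; apply: le_trans le2.
  by rewrite le_eqVlt; apply/orP; left; apply/eqP; field.
by rewrite pmulr_lle0 // invr_gt0.
Qed.

End FixedPoint.

(** * The holomorphic implicit function theorem *)

Section HeadTail.
Context {R : realType} {n : nat}.
Local Notation C := (CC R).
Implicit Types (t : C) (z : 'rV[C]_n) (q : 'rV[C]_n.+1).

(** For n = 2 this is the projection [xy]. *)
Definition tail_rV q : 'rV[C]_n := \row_j q ord0 (lift ord0 j).

Definition pad_rV z : 'rV[C]_n.+1 :=
  \row_i (if unlift ord0 i is Some j then z ord0 j else 0).

(** The vector with coordinate 0 equal to t, followed by z; written as a sum so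
that it is visibly affine in each argument. *)
Definition cons_rV t z : 'rV[C]_n.+1 := t *: evec ord0 + pad_rV z.

Lemma tail_rV_is_linear : linear tail_rV.
Proof. by move=> a u v; apply/rowP => j; rewrite !mxE. Qed.

HB.instance Definition _ :=
  GRing.isLinear.Build C 'rV[C]_n.+1 'rV[C]_n _ tail_rV tail_rV_is_linear.

Lemma pad_rV_is_linear : linear pad_rV.
Proof.
move=> a u v; apply/rowP => i; rewrite !mxE.
by case: unliftP => [j _|_]; rewrite ?mxE ?mulr0 ?addr0.
Qed.

HB.instance Definition _ :=
  GRing.isLinear.Build C 'rV[C]_n 'rV[C]_n.+1 _ pad_rV pad_rV_is_linear.

Lemma pad_rV0 : pad_rV 0 = 0.
Proof. exact: raddf0. Qed.

Lemma cons_rV_head t z : cons_rV t z ord0 ord0 = t.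
Proof. by rewrite !mxE eqxx mulr1 unlift_none addr0. Qed.

Lemma cons_rV_lift t z j : cons_rV t z ord0 (lift ord0 j) = z ord0 j.
Proof. by rewrite !mxE liftK eqxx /= mulr0 add0r. Qed.

Lemma tail_rV_cons_rV t z : tail_rV (cons_rV t z) = z.
Proof. by apply/rowP => j; rewrite mxE cons_rV_lift. Qed.

Lemma cons_rV_tail_rV q : cons_rV (q ord0 ord0) (tail_rV q) = q.
Proof.
apply/rowP => i; case: (unliftP ord0 i) => [j ->|->]; last by rewrite cons_rV_head.
by rewrite cons_rV_lift mxE.
Qed.

Lemma cons_rVB t z s w : cons_rV t z - cons_rV s w = cons_rV (t - s) (z - w).
Proof. by rewrite /cons_rV opprD addrACA -scalerBl -raddfB. Qed.

Lemma ball_cons_rV t0 z0 e t z : `|t0 - t| < e -> ball z0 e z ->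
  ball (cons_rV t0 z0) e (cons_rV t z).
Proof.
move=> te ze; split => [|i i']; first exact: le_lt_trans te.
rewrite !ord1; case: (unliftP ord0 i') => [j ->|->].
  by rewrite !cons_rV_lift; case: ze => _; apply.
by rewrite !cons_rV_head.
Qed.

Lemma continuous_tail_rV : continuous tail_rV.
Proof.
move=> q A /nbhs_ballP[e e0 eA]; apply/nbhs_ballP; exists e => // q' [_ qq'].
by apply: eA; split=> // i j; rewrite !mxE !ord1; apply: qq'.
Qed.

Lemma continuous_pad_rV : continuous pad_rV.
Proof.
move=> q A /nbhs_ballP[e e0 eA]; apply/nbhs_ballP; exists e => // q' [_ qq'].
apply: eA; split=> // i i'; rewrite !mxE !ord1.
by case: unliftP => [j _|_]; [apply: qq'|exact: ballxx].
Qed.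

Lemma cdiff_cons_rV {V : normedModType C} m (U : set V) (f : V -> C) (g : V -> 'rV[C]_n) :
  open U -> cdiff m U f -> cdiff m U g -> cdiff m U (fun p => cons_rV (f p) (g p)).
Proof.
move=> oU df dg; apply: cdiffD => //; first exact: cdiffZl.
exact: cdiff_lin oU continuous_pad_rV dg.
Qed.

Lemma differentiable_cons_rV {V : normedModType C} (f : V -> C) (g : V -> 'rV[C]_n) p :
  differentiable f p -> differentiable g p ->
  differentiable (fun p => cons_rV (f p) (g p)) p.
Proof.
move=> df dg; apply: differentiableD; first exact: differentiableZl.
by apply: differentiable_comp => //; apply: linear_differentiable continuous_pad_rV.
Qed.

Lemma derive_cons_rV {V : normedModType C} (f : V -> C) (g : V -> 'rV[C]_n) p v :
  differentiable f p -> differentiable g p ->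
  'D_v (fun p => cons_rV (f p) (g p)) p = cons_rV ('D_v f p) ('D_v g p).
Proof.
move=> df dg.
have d1 := differentiableZl (evec ord0 : 'rV[C]_n.+1) df.
have d2 : differentiable (pad_rV \o g) p.
  by apply: differentiable_comp => //; apply: linear_differentiable continuous_pad_rV.
rewrite (deriveD (diff_derivable d1) (diff_derivable d2)).
by rewrite (derive_linE v continuous_pad_rV dg) (deriveE _ d1) (diffZl _ df) (deriveE _ df).
Qed.

Lemma tail_rV_evec t : tail_rV (t *: evec ord0) = 0.
Proof. by apply/rowP => j; rewrite !mxE mulr0. Qed.

Lemma derive_head (G : 'rV[C]_n.+1 -> C) q t z : differentiable G q ->
  'D_(cons_rV t z) G q = t * pd ord0 G q + 'D_(pad_rV z) G q.
Proof.
by move=> dG; rewrite /pd !deriveE // linearD linearZ.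
Qed.

End HeadTail.

Section ZeroFunction.
Context {R : realType} {n : nat}.
Local Notation C := (CC R).
Local Notation rc := (real_complex R : R -> C).
Context (W : set 'rV[C]_n.+1) (G : 'rV[C]_n.+1 -> C) (q0 : 'rV[C]_n.+1).
Context (oW : open W) (Wq0 : W q0) (hG : holomorphic W G) (Gq0 : G q0 = 0).
Context (D0 : pd ord0 G q0 != 0).
Let t0 := q0 ord0 ord0.
Let z0 := tail_rV q0.
Let a := pd ord0 G q0.

Lemma implicit_diff q : W q -> differentiable G q.
Proof. by move=> Wq; apply: cdiff_diff (hG 0) Wq. Qed.

(** The bound makes the derivative of the Newton map at most 1/2 in absolute
value. *)
Lemma implicit_nearby : exists2 e : C, 0 < e & forall t z, `|t - t0| < e -> ball z0 e z ->
  W (cons_rV t z) /\ `|a - pd ord0 G (cons_rV t z)| < 2^-1 * `|a|.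
Proof.
have cD : {for q0, continuous (pd ord0 G)}.
  by apply: differentiable_continuous; apply: cdiff_diff Wq0; apply: cdiff_derive (hG 1).
have a0 : 0 < 2^-1 * `|a| by rewrite mulr_gt0 ?invr_gt0 ?normr_gt0.
have : \forall q \near q0, W q /\ `|a - pd ord0 G q| < 2^-1 * `|a|.
  near=> q; split; near: q; first exact: open_nbhs_nbhs.
  by move/cvgrPdist_lt: cD => /(_ _ a0).
move/nbhs_ballP => [e /= e0 eP]; exists e => // t z te ze.
by apply: eP; rewrite -(cons_rV_tail_rV q0); apply: ball_cons_rV => //; rewrite distrC.
Unshelve. all: by end_near. Qed.

Lemma disc_convex (r s t : C) (u : R) : 0 <= u <= 1 -> `|s - t0| <= r -> `|t - t0| <= r ->
  `|s + rc u * (t - s) - t0| <= r.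
Proof.
move=> /andP[u0 u1] sr tr.
have -> : s + rc u * (t - s) - t0 = (1 - rc u) * (s - t0) + rc u * (t - t0) by ring.
have u0' : 0 <= rc u by rewrite (lecR 0 u).
have u1' : 0 <= 1 - rc u by rewrite subr_ge0 (lecR u 1).
apply: le_trans (ler_normD _ _) _.
rewrite !normrM (ger0_norm u0') (ger0_norm u1').
have -> : r = (1 - rc u) * r + rc u * r by ring.
by apply: lerD; apply: ler_wpM2l.
Qed.

(** Newton's map for the equation G (t, z) = 0 in t, with the derivative taken
at the base point: its fixed points are the zeros. *)
Let newton z t := t - a^-1 * G (cons_rV t z).

Lemma newton_contracts (r : C) z : 0 < r ->
  (forall t, `|t - t0| <= r ->
     W (cons_rV t z) /\ `|a - pd ord0 G (cons_rV t z)| < 2^-1 * `|a|) ->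
  forall s t, `|s - t0| <= r -> `|t - t0| <= r ->
  `|newton z s - newton z t| <= 2^-1 * `|s - t|.
Proof.
move=> r0 H s t sr tr; apply: mean_value_complex => u u01 p.
have [Wp pa] := H _ (disc_convex u01 tr sr).
rewrite -/p in Wp pa.
have dp : differentiable (fun t => cons_rV t z) p.
  exact: (@differentiable_cons_rV R n C id (cst z)).
have dGp : differentiable (fun t => G (cons_rV t z)) p.
  exact: (differentiable_comp dp (implicit_diff Wp)).
have dM : differentiable (fun t => a^-1 * G (cons_rV t z)) p.
  exact: (differentiableZ a^-1 dGp).
have did : differentiable (id : C -> C) p by [].
split; first exact: (differentiableB did dM).
have -> : 'D_1 (newton z) p = a^-1 * (a - pd ord0 G (cons_rV p z)).
  rewrite (deriveB (diff_derivable did) (diff_derivable dM)) derive_id.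
  have -> := deriveZ a^-1 (diff_derivable dGp).
  have -> : 'D_1 (fun t => G (cons_rV t z)) p = 'D_('D_1 (fun t => cons_rV t z) p) G (cons_rV p z).
    exact: derive_compE dp (implicit_diff Wp).
  have -> : 'D_1 (fun t => cons_rV t z) p = cons_rV ('D_1 id p) ('D_1 (cst z) p).
    exact: (@derive_cons_rV R n C id (cst z) p 1 did (differentiable_cst _ _)).
  rewrite derive_id derive_cst derive_head; last exact: implicit_diff.
  rewrite pad_rV0 derive0 addr0 mul1r.
  have E (b P : C) : b != 0 -> 1 - b^-1 *: P = b^-1 * (b - P).
    by move=> b0; rewrite mulrBr mulVf.
  exact: E D0.
rewrite normrM normfV mulrC ler_pdivrMr ?normr_gt0 //; exact: ltW.
Qed.

(** The strict bound on tau keeps its values in an open disc, so that the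
uniqueness statement of the implicit function theorem holds on an open set. *)
Lemma implicit_exists : exists (r : C) (V : set 'rV[C]_n) (tau : 'rV[C]_n -> C),
  [/\ 0 < r, open V, V z0 &
    forall t z, `|t - t0| <= r -> V z ->
      W (cons_rV t z) /\ `|a - pd ord0 G (cons_rV t z)| < 2^-1 * `|a|] /\
  forall z, V z -> `|tau z - t0| < r /\ G (cons_rV (tau z) z) = 0.
Proof.
have [e e0 eP] := implicit_nearby; pose r := 2^-1 * e.
have r0 : 0 < r by rewrite mulr_gt0 ?invr_gt0.
have re : r < e by rewrite gtr_pMl // invf_lt1 ?ltr1n.
have b0 : 0 < `|a| * (2^-1 * r) by rewrite mulr_gt0 ?normr_gt0 ?mulr_gt0 ?invr_gt0.
have cG : {for z0, continuous (fun z => G (cons_rV t0 z))}.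
  have dp : differentiable (cons_rV t0) z0.
    exact: (@differentiable_cons_rV R n _ (cst t0) id).
  apply: differentiable_continuous; apply: (differentiable_comp dp); apply: implicit_diff.
  by rewrite cons_rV_tail_rV.
have : \forall z \near z0, ball z0 e z /\ `|G (cons_rV t0 z)| < `|a| * (2^-1 * r).
  near=> z; split; near: z; first exact: nbhsx_ballx.
  move/cvgrPdist_lt: cG => /(_ _ b0); apply: filterS => z.
  by rewrite cons_rV_tail_rV Gq0 sub0r normrN.
rewrite -nbhs_nearE nbhsE => -[V [oV Vz0] VP].
have H t z : `|t - t0| <= r -> V z ->
    W (cons_rV t z) /\ `|a - pd ord0 G (cons_rV t z)| < 2^-1 * `|a|.
  by move=> tr /VP[ze _]; apply: eP => //; apply: le_lt_trans re.
have Nt0 z : V z -> `|newton z t0 - t0| < 2^-1 * r.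
  move=> /VP[_]; rewrite /newton addrAC subrr add0r normrN normrM normfV.
  by rewrite ltr_pdivrMl ?normr_gt0.
have rr : 2^-1 * r + 2^-1 * r = r by field.
have Nin z t : V z -> `|t - t0| <= r -> `|newton z t - t0| <= 2^-1 * `|t - t0| + `|newton z t0 - t0|.
  move=> Vz tr; rewrite -(subrKA (newton z t0)) (le_trans (ler_normD _ _)) // lerD2r.
  apply: (@newton_contracts r) => //; first by move=> s sr; apply: H.
  by rewrite subrr normr0 ltW.
have /choice[tau tauP] : forall z, exists t : C, V z -> `|t - t0| <= r /\ newton z t = t.
  move=> z.
  have [Vz|nVz] := pselect (V z); last by exists 0.
  have [||t] := @contraction_disc R (newton z) t0 r (ltW r0).
  - move=> t tr; apply: le_trans (Nin z t Vz tr) _; rewrite -rr.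
    by apply: lerD; [rewrite ler_pM2l ?invr_gt0|exact/ltW/Nt0].
  - by apply: newton_contracts => // t tr; apply: H.
  - by move=> tr Nt; exists t.
exists r, V, tau; split; first by split.
move=> z Vz; have [tr Nt] := tauP z Vz; split.
  rewrite -{1}Nt; apply: le_lt_trans (Nin z _ Vz tr) _; rewrite -rr.
  by apply: ler_ltD; [rewrite ler_pM2l ?invr_gt0|exact/Nt0].
move/eqP: Nt; rewrite /newton -subr_eq0 addrAC subrr add0r oppr_eq0 mulf_eq0 invr_eq0.
by rewrite (negbTE D0) => /eqP.
Unshelve. all: by end_near. Qed.

(** A zero s is at distance at most twice the Newton correction from any t of the
disc.  With G (t, z) = 0 this is uniqueness; with t a zero for a nearby z it
bounds the increments of the implicit function. *)
Lemma implicit_error_bound (r t s : C) z : 0 < r ->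
  (forall t, `|t - t0| <= r ->
     W (cons_rV t z) /\ `|a - pd ord0 G (cons_rV t z)| < 2^-1 * `|a|) ->
  `|s - t0| <= r -> `|t - t0| <= r -> G (cons_rV s z) = 0 ->
  `|s - t| <= 2 * `|a^-1 * G (cons_rV t z)|.
Proof.
move=> r0 H sr tr Gs.
have : `|s - t| <= 2^-1 * `|s - t| + `|a^-1 * G (cons_rV t z)|.
  have {1}-> : s - t = (newton z s - newton z t) - a^-1 * G (cons_rV t z).
    by rewrite /newton Gs; ring.
  apply: le_trans (ler_normB _ _) _; rewrite lerD2r.
  exact: newton_contracts H _ _ sr tr.
rewrite -lerBlDl => h.
have -> : `|s - t| = 2 * (`|s - t| - 2^-1 * `|s - t|) by field.
by rewrite ler_pM2l.
Qed.

End ZeroFunction.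

Section ImplicitRegularity.
Context {R : realType} {n : nat}.
Local Notation C := (CC R).

(** Write q = (tau z, z), b for the derivative of G at q in the head direction,
and expand 0 = G (tau (z + h), z + h) at q: b (tau (z + h) - tau z) plus the
differential of G at (0, h) is o of the increment of q.  The a priori bound on
tau makes this increment O(h), and dividing by b gives the differential. *)
Lemma implicit_differentiable (V : set 'rV[C]_n) (G : 'rV[C]_n.+1 -> C)
    (tau : 'rV[C]_n -> C) (k : C) z :
  open V -> V z -> differentiable G (cons_rV (tau z) z) ->
  pd ord0 G (cons_rV (tau z) z) != 0 ->
  (forall w, V w -> G (cons_rV (tau w) w) = 0) ->
  0 < k ->
  (forall w, V w -> `|tau w - tau z| <= k * `|G (cons_rV (tau z) w)|) ->
  differentiable tau z.
Proof.
move=> oV Vz dG b0 Gtau k0 kP; set s := tau z in dG b0 *; set q := cons_rV s z in dG b0.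
set b := pd ord0 G q in b0.
pose g h := - b^-1 * 'd G q (pad_rV h).
have glin : linear g.
  by move=> l u v; rewrite /g [pad_rV _]linearP ['d G q _]linearP mulrDr -scalerAr.
pose glM := GRing.isLinear.Build _ _ _ _ _ glin.
pose L : {linear _ -> _} := HB.pack g glM.
have cdG : continuous ('d G q) by apply: diff_continuous.
have cL : continuous L.
  move=> h; apply: (@cvgMr C 'rV[C]_n (nbhs h) _ (fun h => 'd G q (pad_rV h)) (- b^-1)).
  exact: (continuous_comp (@continuous_pad_rV R n h) (cdG _)).
have lip : exists2 c : C, 0 < c & \forall h \near (0 : 'rV[C]_n), `|tau (h + z) - s| <= c * `|h|.
  have dgz : differentiable (fun w => G (cons_rV s w)) z.
    have dp : differentiable (cons_rV s) z.
      exact: (@differentiable_cons_rV R n _ (cst s) id).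
    exact: (differentiable_comp dp dG).
  have [c c0 cP] := diff_lipschitz dgz.
  exists (k * c); first by rewrite mulr_gt0.
  have nV : \forall h \near (0 : 'rV[C]_n), V (h + z).
    have := open_nbhs_nbhs (conj oV Vz); rewrite nbhs_nearE (near_shift 0 z).
    by rewrite subr0.
  apply: filterS2 nV cP => h Vh; rewrite (Gtau _ Vz) subr0 => cG.
  by apply: le_trans (kP _ Vh) _; rewrite -mulrA ler_pM2l.
have [c c0 cP] := lip.
have [kp kp0 kpP] := linear_lipschitz (@continuous_pad_rV R n).
pose K := c * `|evec ord0 : 'rV[C]_n.+1| + kp.
have K0 : 0 < K by rewrite /K ltr_wpDl // mulr_ge0 // ltW.
have nK : \forall h \near (0 : 'rV[C]_n), `|cons_rV (tau (h + z) - s) h| <= K * `|h|.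
  apply: filterS cP => h ch.
  rewrite /cons_rV /K mulrDl; apply: (le_trans (ler_normD _ _)).
  apply: lerD; last exact: kpP.
  rewrite normrZ mulrAC.
  by apply: ler_wpM2r.
apply: (remainder_diff cL) => e e0.
have e1 : 0 < e * `|b| / K by rewrite divr_gt0 // mulr_gt0 // normr_gt0.
have := diff_remainder dG e1 => /nbhs_ballP[d /= d0 dP].
have nV : \forall h \near (0 : 'rV[C]_n), V (h + z).
  have := open_nbhs_nbhs (conj oV Vz); rewrite nbhs_nearE (near_shift 0 z).
  by rewrite subr0.
have nd : \forall h \near (0 : 'rV[C]_n), K * `|h| < d.
  have dK : 0 < d / K by rewrite divr_gt0.
  have := @nbhs0_lt C 'rV[C]_n _ dK.
  by apply: filterS => h; rewrite ltr_pdivlMr // mulrC.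
near=> h.
have Vh : V (h + z) by near: h.
have hd : K * `|h| < d by near: h.
have hK : `|cons_rV (tau (h + z) - s) h| <= K * `|h| by near: h.
have bh : ball 0 d (cons_rV (tau (h + z) - s) h).
  by rewrite -ball_normE /= sub0r normrN; apply: le_lt_trans hd.
have := dP _ bh.
have -> : cons_rV (tau (h + z) - s) h + q = cons_rV (tau (h + z)) (h + z).
  by rewrite -[X in cons_rV _ X + _](addrK z) -cons_rVB subrK.
have Gq : G q = 0 := Gtau _ Vz.
rewrite (Gtau _ Vh) Gq !add0r normrN.
rewrite -(deriveE _ dG) derive_head // (deriveE _ dG) -/b.
have -> : (tau (h + z) - s) * b + 'd G q (pad_rV h) = b * (tau (h + z) - (s + L h)).
  rewrite /= /g. by field.
rewrite normrM -ler_pdivlMl ?normr_gt0 // => /le_trans; apply.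
rewrite ler_pdivrMl ?normr_gt0 //.
apply: le_trans (ler_wpM2l (ltW e1) hK) _.
by rewrite mulrA divfK ?gt_eqF // mulrAC mulrC mulrA.
Unshelve. all: by end_near. Qed.

(** Differentiating G (tau z, z) = 0 expresses the derivative of tau as a quotient
of derivatives of G composed with z |-> (tau z, z); so tau gains one order of
differentiability at each step. *)
Lemma cdiff_implicit (W : set 'rV[C]_n.+1) (V : set 'rV[C]_n) (G : 'rV[C]_n.+1 -> C)
    (tau : 'rV[C]_n -> C) :
  open W -> open V -> holomorphic W G ->
  (forall z, V z -> W (cons_rV (tau z) z)) ->
  (forall z, V z -> pd ord0 G (cons_rV (tau z) z) != 0) ->
  (forall z, V z -> G (cons_rV (tau z) z) = 0) ->
  (forall z, V z -> differentiable tau z) ->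
  holomorphic V tau.
Proof.
move=> oW oV hG VW b0 Gtau dtau.
have dG z : V z -> differentiable G (cons_rV (tau z) z).
  by move=> Vz; apply: cdiff_diff (hG 0) (VW _ Vz).
have hpd v : holomorphic W (fun q => 'D_v G q) by move=> m; apply: cdiff_derive (hG m.+1).
elim=> [|m IH]; first by split.
split => // v.
have cid : cdiff m V id by apply: cdiff_id.
have cpt : cdiff m V (fun z => cons_rV (tau z) z) by apply: cdiff_cons_rV.
pose f1 z := pd ord0 G (cons_rV (tau z) z).
pose f2 z := 'D_(pad_rV v) G (cons_rV (tau z) z).
have cf1 : cdiff m V f1 by apply: (cdiff_comp_scalar oV oW VW cpt (hpd _ m)).
have cf2 : cdiff m V f2 by apply: (cdiff_comp_scalar oV oW VW cpt (hpd _ m)).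
apply: (@cdiff_eq _ _ _ _ _ (cst (-1) * ((fun z => (f1 z)^-1) * f2))) => //; last first.
  apply: cdiffM => //; first exact: cdiff_cst.
  by apply: cdiffM => //; apply: cdiffV.
move=> z Vz; rewrite !fctE.
have did : differentiable id z by [].
have dpt := differentiable_cons_rV (dtau _ Vz) did.
have : 'D_v (G \o (fun z => cons_rV (tau z) z)) z = 0.
  rewrite (@near_eq_derive _ _ _ _ (cst 0)) ?derive_cst //.
  by near=> w; apply: Gtau; near: w; apply: open_nbhs_nbhs.
rewrite (derive_compE v dpt (dG _ Vz)) (derive_cons_rV v (dtau _ Vz) did) derive_id.
rewrite (derive_head _ _ (dG _ Vz)) -/(f1 z) -/(f2 z) => /eqP.
rewrite addr_eq0 => /eqP E.
apply: (mulIf (b0 _ Vz)); rewrite E -/(f1 z).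
by rewrite mulN1r mulNr mulrAC mulVf ?mul1r //; exact: b0.
Unshelve. all: by end_near. Qed.

End ImplicitRegularity.

Section ImplicitTheorem.
Context {R : realType} {n : nat}.
Local Notation C := (CC R).

(** B is a box around q0 with base V, in which the zero set of G is the graph of
tau. *)
Theorem implicit_function (W : set 'rV[C]_n.+1) (G : 'rV[C]_n.+1 -> C) q0 :
  open W -> W q0 -> holomorphic W G -> G q0 = 0 -> pd ord0 G q0 != 0 ->
  exists (B : set 'rV[C]_n.+1) (V : set 'rV[C]_n) (tau : 'rV[C]_n -> C),
    [/\ open B, B q0, B `<=` W, open V & holomorphic V tau] /\
    [/\ forall q, B q -> V (tail_rV q),
        forall z, V z -> B (cons_rV (tau z) z),
        forall z, V z -> G (cons_rV (tau z) z) = 0 &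
        forall q, B q -> G q = 0 -> q ord0 ord0 = tau (tail_rV q)].
Proof.
move=> oW Wq0 hG Gq0 D0.
have [r [V [tau [[r0 oV Vz0 H] tauP]]]] := implicit_exists oW Wq0 hG Gq0 D0.
set t0 := q0 ord0 ord0 in H tauP; set a := pd ord0 G q0 in D0 H.
have uniq z s t : V z -> `|s - t0| <= r -> `|t - t0| <= r ->
    G (cons_rV s z) = 0 -> `|s - t| <= 2 * `|a^-1 * G (cons_rV t z)|.
  move=> Vz; apply: (implicit_error_bound hG D0 r0) => u ur; exact: H.
have b0 t z : `|t - t0| <= r -> V z -> pd ord0 G (cons_rV t z) != 0.
  move=> tr Vz; have [_] := H _ _ tr Vz; apply: contraTneq => ->.
  by rewrite subr0 -real_leNgt ?normr_real ?realM ?normr_real // -[leRHS]mul1r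
    ler_pM2r ?normr_gt0 // invf_le1 ?ler1n.
have tr z (Vz : V z) : `|tau z - t0| <= r by have [/ltW] := tauP _ Vz.
have VW z : V z -> W (cons_rV (tau z) z).
  by move=> Vz; have [] := H _ _ (tr _ Vz) Vz.
have Gtau z : V z -> G (cons_rV (tau z) z) = 0 by move=> /tauP[].
have hol : holomorphic V tau.
  have bV z (Vz : V z) : pd ord0 G (cons_rV (tau z) z) != 0 := b0 _ _ (tr _ Vz) Vz.
  apply: (cdiff_implicit oW oV hG VW bV Gtau) => z Vz.
  have k0 : 0 < 2 * `|a^-1| by rewrite mulr_gt0 // normr_gt0 invr_eq0.
  apply: (implicit_differentiable oV Vz (cdiff_diff (hG 0) (VW _ Vz)) (bV _ Vz) Gtau k0).
  by move=> w Vw; rewrite -mulrA -normrM; apply: uniq => //; [exact: tr|exact: tr|exact: Gtau].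
exists [set q | V (tail_rV q) /\ `|t0 - q ord0 ord0| < r], V, tau; split; split => //.
- apply: openI; first exact: open_comp (fun q _ => @continuous_tail_rV R n q) oV.
  apply: (@open_comp _ _ (@rV_coord R n.+1 ord0) (ball t0 r)) => [q _|].
    exact: continuous_coord.
  exact: ball_open.
- by rewrite /= subrr normr0.
- by move=> q [Vq qr]; rewrite -(cons_rV_tail_rV q); apply: (H _ _ _ Vq).1; rewrite distrC ltW.
- by move=> q [].
- by move=> z Vz; rewrite /= tail_rV_cons_rV cons_rV_head distrC; split=> //; have [] := tauP _ Vz.
- move=> q [Vq qr] Gq; apply/eqP; rewrite -subr_eq0 -normr_le0.
  have := uniq (tail_rV q) (q ord0 ord0) (tau (tail_rV q)) Vq.
  rewrite cons_rV_tail_rV (Gtau _ Vq) mulr0 normr0 mulr0; apply => //; last exact: tr.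
  by rewrite distrC ltW.
Qed.

End ImplicitTheorem.

(** * Idempotents of three-dimensional algebras *)

Section TernaryAlgebra.
Context {R : realType}.
Local Notation C := (CC R).
Local Notation V := 'rV[C]_3.
Context (m : V -> V -> V).
Context (mDl : forall u v w, m (u + v) w = m u w + m v w).
Context (mZl : forall (k : C) u v, m (k *: u) v = k *: m u v).
Context (mC : forall u v, m u v = m v u).
Context (mA : forall u v w, m (m u v) w = m u (m v w)).
Local Notation e := (evec ord0 : V).
Context (m1 : forall v, m e v = v).

Definition det2 (u v : 'rV[C]_2) : C :=
  u ord0 ord0 * v ord0 ord_max - u ord0 ord_max * v ord0 ord0.

Definition frame (T : 'M[C]_3) : Prop :=
  [/\ T \in unitmx,
      forall i j, m (row i T) (row j T) = if i == j then row i T else 0 &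
      e = \sum_i row i T].

(** The determinant of (e, v, m v v). *)
Definition square_cubic (v : V) : C := det2 (tail_rV v) (tail_rV (m v v)).

Lemma tail_rV_eq0 (v : V) : tail_rV v = 0 -> v = v ord0 ord0 *: e.
Proof. by move=> v0; rewrite -{1}(cons_rV_tail_rV v) v0 /cons_rV pad_rV0 addr0. Qed.

Lemma det2_dep (u v : 'rV[C]_2) : det2 u v = 0 ->
  exists a b : C, (a != 0) || (b != 0) /\ a *: u + b *: v = 0.
Proof.
rewrite /det2; set a := u _ _; set b := v _ ord_max; set c := u _ ord_max; set d := v _ _.
move=> D.
have uv (x y : C) : x * a + y * d = 0 -> x * c + y * b = 0 -> x *: u + y *: v = 0.
  move=> h0 h1; apply/rowP => j; rewrite !mxE.
  by have [->|->] : j = ord0 \/ j = ord_max by case: j => [[|[|?]]] //= ?; [left|right]; apply/val_inj.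
have [a0|a0] := eqVneq a 0; last first.
  exists d, (- a); split; first by rewrite oppr_eq0 a0 orbT.
  by apply: uv; [ring|rewrite -[RHS]oppr0 -D; ring].
have [c0|c0] := eqVneq c 0; last first.
  exists b, (- c); split; first by rewrite oppr_eq0 c0 orbT.
  by apply: uv; [rewrite -D; ring|ring].
exists 1, 0; split; first by rewrite oner_neq0.
by apply: uv; rewrite ?a0 ?c0; ring.
Qed.

Lemma third_index (i j : 'I_3) : i != j -> exists k : 'I_3,
  [/\ k != i, k != j & forall f : 'I_3 -> V, \sum_l f l = f i + f j + f k].
Proof.
move=> ij.
have [k /andP[ki kj]] : exists k : 'I_3, (k != i) && (k != j).
  by case: i j ij => [[|[|[|?]]] ?] [[|[|[|?]]] ?] // _;
   first [exists (inord 0); by rewrite -!val_eqE /= inordK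
         |exists (inord 1); by rewrite -!val_eqE /= inordK
         |exists (inord 2); by rewrite -!val_eqE /= inordK].
exists k; split=> // f.
rewrite (bigD1 i) //= (bigD1 j) 1?eq_sym //= (bigD1 k) ?ki ?kj //= big_pred0 ?addr0 ?addrA // => l.
by move: i j k l ij ki kj => [[|[|[|?]]] ?] [[|[|[|?]]] ?] [[|[|[|?]]] ?] [[|[|[|?]]] ?].
Qed.

Lemma frame_free T (c : 'I_3 -> C) : T \in unitmx ->
  \sum_i c i *: row i T = 0 -> forall i, c i = 0.
Proof.
move=> uT cT i; pose d : V := \row_k c k.
have dT : d *m T = 0.
  by rewrite mulmx_sum_row -[RHS]cT; apply: eq_bigr => k _; rewrite mxE.
have d0 : d = 0 by rewrite -(mulmxK uT d) dT mul0mx.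
by have /rowP/(_ i) := d0; rewrite !mxE.
Qed.

Lemma frame_indep T (a b c : C) i j : frame T -> i != j ->
  a *: row i T + b *: row j T = c *: e -> a = 0 /\ b = 0.
Proof.
case=> uT _ eT ij E.
have dk k : a * (k == i)%:R + b * (k == j)%:R - c = 0.
  move: k; apply: (frame_free uT).
  transitivity (a *: row i T + b *: row j T - c *: e); last by rewrite E subrr.
  rewrite {1}eT scaler_sumr.
  rewrite (eq_bigr (fun k => a * (k == i)%:R *: row k T + b * (k == j)%:R *: row k T - c *: row k T)).
    rewrite sumrB big_split /=; congr (_ + _ - _).
      by rewrite (bigD1 i) //= eqxx mulr1 big1 ?addr0 // => k /negbTE ->; rewrite mulr0 scale0r.
    by rewrite (bigD1 j) //= eqxx mulr1 big1 ?addr0 // => k /negbTE ->; rewrite mulr0 scale0r.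
  by move=> k _; rewrite scalerBl scalerDl.
have [k [ki kj _]] := third_index ij.
have c0 : c = 0.
  by have := dk k; rewrite (negbTE ki) (negbTE kj) !mulr0 add0r sub0r => /eqP; rewrite oppr_eq0 => /eqP.
have := dk i; have := dk j; rewrite !eqxx (negbTE ij) eq_sym (negbTE ij) c0 !mulr0 !mulr1 !subr0.
by rewrite addr0 add0r => -> ->.
Qed.

Lemma frame_cubic T i : frame T -> square_cubic (row i T) = 0.
Proof. by case=> _ mT _; rewrite /square_cubic mT eqxx /det2 mulrC subrr. Qed.

Lemma frame_det2 T i j : frame T -> i != j ->
  det2 (tail_rV (row i T)) (tail_rV (row j T)) != 0.
Proof.
move=> fT ij; apply/eqP => /det2_dep[a [b [ab E]]].
have : tail_rV (a *: row i T + b *: row j T) = 0 by rewrite linearD !linearZ.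
move/tail_rV_eq0 => /(frame_indep fT ij)[a0 b0].
by move: ab; rewrite a0 b0 eqxx.
Qed.

Lemma alg_mulDr u v w : m u (v + w) = m u v + m u w.
Proof. by rewrite mC mDl !(mC u). Qed.

Lemma alg_mulZr (k : C) u v : m u (k *: v) = k *: m u v.
Proof. by rewrite mC mZl (mC u). Qed.

Lemma alg_mulNl u v : m (- u) v = - m u v.
Proof. by rewrite -scaleN1r mZl scaleN1r. Qed.

Lemma alg_mulNr u v : m u (- v) = - m u v.
Proof. by rewrite mC alg_mulNl (mC u). Qed.

Lemma alg_mul0l v : m 0 v = 0.
Proof. by have := mZl 0 e v; rewrite !scale0r. Qed.

Lemma alg_mulr1 v : m v e = v. Proof. by rewrite mC. Qed.

Lemma square_expand (t a b : C) (u w : V) : let v := t *: e + a *: u + b *: w in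
  m v v = t *: (2 *: v - t *: e) + (a ^+ 2 *: m u u + (2 * a * b) *: m u w + b ^+ 2 *: m w w).
Proof.
move=> v; rewrite {1 2}/v !(mDl, alg_mulDr, alg_mulNl, alg_mulNr, mZl, alg_mulZr) !m1 !alg_mulr1 (mC w u) /v.
by apply/rowP => l; rewrite !mxE; ring.
Qed.

(** In a frame of idempotents v has coordinates l_i and v . v has coordinates
l_i^2.  A linear relation between e, v and v . v is a polynomial of degree at
most 2 vanishing at all l_i, so that two of them are equal, to l say; then v is
l e plus a multiple of the third idempotent. *)
Lemma cubic_root_frame T v : frame T -> square_cubic v = 0 ->
  exists i (a b : C), v = a *: e + b *: row i T.
Proof.
move=> fT; have [uT mT eT] := fT; pose l := v *m invmx T.
have vE : v = \sum_i l ord0 i *: row i T by rewrite -mulmx_sum_row mulmxKV.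
have v2 : m v v = \sum_i (l ord0 i ^+ 2) *: row i T.
  rewrite [in LHS]vE !big_ord_recl !big_ord0 !addr0.
  rewrite !(mDl, alg_mulDr, alg_mulNl, alg_mulNr, mZl, alg_mulZr) !mT /= !scaler0 !addr0 !add0r.
  by rewrite !scalerA.
move=> /det2_dep[a [b [ab E]]].
have : tail_rV (a *: v + b *: m v v) = 0 by rewrite linearD !linearZ.
move/tail_rV_eq0; set c := _ ord0 ord0 => Ec.
have lP i : a * l ord0 i + b * l ord0 i ^+ 2 - c = 0.
  move: i; apply: (frame_free uT).
  transitivity (a *: v + b *: m v v - c *: e); last by rewrite Ec subrr.
  rewrite v2 {1}vE {1}eT !scaler_sumr -big_split -sumrB /=; apply: eq_bigr => i _.
  by rewrite scalerBl scalerDl !scalerA.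
pose i0 : 'I_3 := ord0; pose i1 : 'I_3 := lift ord0 ord0; pose i2 : 'I_3 := lift ord0 (lift ord0 ord0).
have pairs i j : l ord0 i = l ord0 j \/ a + b * (l ord0 i + l ord0 j) = 0.
  have : (l ord0 i - l ord0 j) * (a + b * (l ord0 i + l ord0 j)) = 0.
    transitivity ((a * l ord0 i + b * l ord0 i ^+ 2 - c) - (a * l ord0 j + b * l ord0 j ^+ 2 - c)).
      by ring.
    by rewrite !lP subrr.
  by move/eqP; rewrite mulf_eq0 subr_eq0 => /orP[/eqP|/eqP]; [left|right].
have [i [j [k [ij E3]]]] : exists i j k, l ord0 i = l ord0 j /\
    forall f : 'I_3 -> V, \sum_i f i = f i + f j + f k.
  have [h|h1] := pairs i0 i1.
    by exists i0, i1, i2; split=> // f; rewrite !big_ord_recl big_ord0 addr0 addrA.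
  have [h|h2] := pairs i0 i2.
    by exists i0, i2, i1; split=> // f; rewrite !big_ord_recl big_ord0 addr0 addrA addrAC.
  exists i1, i2, i0; split; last first.
    by move=> f; rewrite !big_ord_recl big_ord0 addr0 addrC.
  have b0 : b != 0.
    apply: contraTneq ab => b0; move: h1; rewrite b0 mul0r addr0 => ->.
    by rewrite eqxx.
  apply: (mulfI b0); apply: (addrI (a + b * l ord0 i0)).
  by rewrite -!addrA -!mulrDr h1 h2.
exists k, (l ord0 i), (l ord0 k - l ord0 i).
rewrite [LHS]vE eT !E3 -ij; move: (l ord0 i) (l ord0 k) => x y.
by apply/rowP => q; rewrite !mxE; ring.
Qed.

Lemma det2_indep (u v : 'rV[C]_2) (a b : C) : det2 u v != 0 ->
  a *: u + b *: v = 0 -> a = 0 /\ b = 0.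
Proof.
move=> D E.
have ha : a * det2 u v = det2 (a *: u + b *: v) v by rewrite /det2 !mxE; ring.
have hb : b * det2 u v = det2 u (a *: u + b *: v) by rewrite /det2 !mxE; ring.
split; apply: (mulIf D); rewrite mul0r.
  by rewrite ha E /det2 !mxE !mul0r subrr.
by rewrite hb E /det2 !mxE !mulr0 subrr.
Qed.

(** Let g = s_0 + s_1 + s_2 as a multiple of e.  Squaring s_k = g - s_i - s_j
gives the product s_i s_j as a combination of e and s_i + s_j; multiplying by
s_i and comparing coefficients on the independent vectors s_i, s_j, e gives
s_i^2 = g^2 and s_i s_j = g (s_i + s_j) - g^2.  If g were zero all these products
would vanish and every v . v would be a combination of v and e, so that the
cubic would be zero.  Hence (e - s_i / g) / 2 are orthogonal idempotents, with
sum e. *)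
Lemma frame_of_square_roots (s : 'I_3 -> V) (b : 'I_3 -> C) (g : C) :
  (exists v, square_cubic v != 0) ->
  (forall i, m (s i) (s i) = b i *: e) ->
  \sum_i s i = g *: e ->
  (forall i j, i != j -> det2 (tail_rV (s i)) (tail_rV (s j)) != 0) ->
  exists T, frame T.
Proof.
move=> [v vP] s2 sg sI.
have e0 (c : C) : c *: e = 0 -> c = 0.
  by move=> /rowP/(_ ord0); rewrite !mxE eqxx mulr1.
have indep i j (x y z : C) : i != j -> x *: s i + y *: s j = z *: e ->
    [/\ x = 0, y = 0 & z = 0].
  move=> ij E.
  have [x0 y0] : x = 0 /\ y = 0.
    by apply: det2_indep (sI _ _ ij) _; rewrite -!linearZ -linearD /= E tail_rV_evec.
  by split=> //; apply: e0; rewrite -E x0 y0 !scale0r addr0.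
have prod i j : i != j -> b i = g ^+ 2 /\
    m (s i) (s j) = g *: (s i + s j) - g ^+ 2 *: e.
  move=> ij; have [k [ki kj S3]] := third_index ij.
  have sk : s k = g *: e - s i - s j by rewrite -sg S3; apply/rowP => l; rewrite !mxE; ring.
  (* from s_k . s_k = b k, with s_k = g - s_i - s_j *)
  pose d := 2^-1 * (b k - b i - b j - g ^+ 2).
  have mij : m (s i) (s j) = d *: e + g *: (s i + s j).
    have := s2 k; rewrite sk.
    rewrite !(mDl, alg_mulDr, alg_mulNl, alg_mulNr, mZl, alg_mulZr) (mC (s j) (s i)) !s2 !m1 !alg_mulr1.
    move: (m (s i) (s j)) => w /rowP h; apply/rowP => l; have := h l; rewrite /d !mxE.
    move/eqP; rewrite -subr_eq0 => /eqP h'.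
    by rewrite -[LHS]addr0 -[X in _ + X](mulr0 (- 2^-1)) -h'; field.
  (* (s_i . s_i) . s_j = s_i . (s_i . s_j) *)
  have := mA (s i) (s i) (s j).
  rewrite s2 mZl m1 mij !(alg_mulDr, alg_mulZr) s2 alg_mulr1 mij => E.
  have E' : (d + g ^+ 2) *: s i + (g ^+ 2 - b i) *: s j = (- (g * b i + g * d)) *: e.
    apply/rowP => l; move/rowP/(_ l): E; rewrite !mxE => /eqP.
    by rewrite -subr_eq0 => /eqP E; rewrite -[LHS]addr0 -E; ring.
  have [h1 h2 _] := indep _ _ _ _ _ ij E'.
  split; first by apply/esym/eqP; rewrite -subr_eq0 h2.
  rewrite addrC; congr (_ + _); rewrite -scaleNr; congr (_ *: _).
  by apply/eqP; rewrite -addr_eq0 h1.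
have b2 i : b i = g ^+ 2.
  have [j ij] : exists j : 'I_3, i != j.
    by case: (eqVneq i ord0) => [->|]; [exists ord_max|exists ord0].
  by have [] := prod _ _ ij.
have g0 : g != 0.
  apply/eqP => g0; case/negP: vP; apply/eqP.
  pose i : 'I_3 := ord0; pose j : 'I_3 := ord_max; have ij : i != j by [].
  pose D := det2 (tail_rV (s i)) (tail_rV (s j)).
  have D0 : D != 0 by apply: sI.
  (* Cramer's rule, in the plane *)
  pose x := det2 (tail_rV v) (tail_rV (s j)) / D; pose y := det2 (tail_rV (s i)) (tail_rV v) / D.
  have : tail_rV (v - (x *: s i + y *: s j)) = 0.
    apply/rowP => l; rewrite linearB linearD !linearZ /= /x /y.
    move: D0; rewrite /D /det2; move: (tail_rV v) (tail_rV (s i)) (tail_rV (s j)) => w1 w2 w3.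
    rewrite !mxE.
    have [->|->] : l = ord0 \/ l = ord_max by case: l => [[|[|?]]] //= ?; [left|right]; apply/val_inj.
      by move=> D0; field.
    by move=> D0; field.
  move/tail_rV_eq0; set z := _ ord0 ord0 => vz.
  have vE : v = x *: s i + y *: s j + z *: e by rewrite -vz addrC subrK.
  clear vz; clearbody x y z.
  have m0 k l : m (s k) (s l) = 0.
    have [<-|kl] := eqVneq k l; first by rewrite s2 b2 g0 expr0n scale0r.
    by have [_ ->] := prod _ _ kl; rewrite g0 expr0n !scale0r subrr.
  have v2 : m v v = (2 * z) *: v - (z ^+ 2) *: e.
    rewrite vE !(mDl, alg_mulDr, alg_mulNl, alg_mulNr, mZl, alg_mulZr) !m0 !m1 !alg_mulr1 !scaler0.
    move: (s i) (s j) (z : C) => p q z'; clear -p q z'.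
    by apply/rowP => l; rewrite !mxE; ring.
  have t2 : tail_rV (m v v) = (2 * z) *: tail_rV v by rewrite v2 linearB /= tail_rV_evec subr0 linearZ.
  by rewrite /square_cubic t2 /det2 !mxE; ring.
pose T : 'M[C]_3 := \matrix_i (2^-1 *: (e - g^-1 *: s i)).
have rT i : row i T = 2^-1 *: (e - g^-1 *: s i) by rewrite rowK.
have Tid i j : m (row i T) (row j T) = if i == j then row i T else 0.
  rewrite !rT !(mDl, alg_mulDr, alg_mulNl, alg_mulNr, mZl, alg_mulZr) !m1 !alg_mulr1.
  have [<-|ij] := eqVneq i j.
    by rewrite s2 b2; apply/rowP => l; rewrite !mxE; field.
  by have [_ ->] := prod _ _ ij; apply/rowP => l; rewrite !mxE; field.
have Tsum : e = \sum_i row i T.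
  rewrite (eq_bigr _ (fun i _ => rT i)) -scaler_sumr sumrB -scaler_sumr sg.
  rewrite sumr_const card_ord; apply/rowP => l; rewrite !mxE mulr2n; field.
  exact: g0.
exists T; split=> //.
rewrite -row_free_unit; apply: inj_row_free => c cT.
apply/rowP => k; rewrite mxE.
have : m (c *m T) (row k T) = 0 by rewrite cT alg_mul0l.
rewrite mulmx_sum_row (big_morph (fun u => m u (row k T)) (fun u w => mDl u w _) (alg_mul0l _)).
rewrite (bigD1 k) //= big1 ?addr0 => [|l lk]; last by rewrite mZl Tid (negbTE lk) scaler0.
rewrite mZl Tid eqxx => /eqP; rewrite scaler_eq0 => /orP[/eqP //|/eqP rk0].
have sk : s k = g *: e.
  move: rk0; rewrite rT => /eqP; rewrite scaler_eq0 invr_eq0 pnatr_eq0 /= subr_eq0.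
  by move=> /eqP ->; rewrite scalerA mulfV // scale1r.
have [j kj] : exists j : 'I_3, k != j.
  by case: (eqVneq k ord0) => [->|]; [exists ord_max|exists ord0].
by have := sI _ _ kj; rewrite sk tail_rV_evec /det2 !mxE !mul0r subrr eqxx.
Qed.

(** A root u satisfies a quadratic equation over the scalars, since u . u is a
combination of u and e; completing the square makes u . u a multiple of e.
Three vectors of the plane have a linear relation, given by their 2 x 2
determinants: after rescaling by these the sum is also a multiple of e. *)
Lemma idempotent_frame_of_roots (u : 'I_3 -> V) :
  (exists v, square_cubic v != 0) ->
  (forall i, square_cubic (u i) = 0) ->
  (forall i j, i != j -> det2 (tail_rV (u i)) (tail_rV (u j)) != 0) ->
  exists T, frame T.
Proof.
move=> [v0 v0P] uP uI.
pose i0 : 'I_3 := ord0; pose i1 : 'I_3 := lift ord0 ord0; pose i2 : 'I_3 := lift ord0 (lift ord0 ord0).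
have quad i : exists a b : C, m (u i) (u i) = a *: u i + b *: e.
  have [a [b [ab E]]] := det2_dep (uP i).
  have : tail_rV (a *: u i + b *: m (u i) (u i)) = 0 by rewrite linearD !linearZ.
  move/tail_rV_eq0; set c := _ ord0 ord0 => Ec.
  have b0 : b != 0.
    apply/eqP => b0; move: ab E; rewrite b0 eqxx orbF scale0r addr0 => a0 /eqP.
    rewrite scaler_eq0 (negbTE a0) => /eqP u0.
    have [j ij] : exists j : 'I_3, i != j.
      by case: (eqVneq i i0) => [->|]; [exists i1|exists i0].
    by have := uI _ _ ij; rewrite u0 /det2 !mxE !mul0r subrr eqxx.
  exists (- (b^-1 * a)), (b^-1 * c).
  rewrite -scalerA -Ec scalerDr !scalerA mulVf // scale1r scaleNr addrA addNr.
  by rewrite add0r.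
(* with these weights the projections of the u i have sum zero *)
pose d i : C := if i == i0 then det2 (tail_rV (u i1)) (tail_rV (u i2))
  else if i == i1 then det2 (tail_rV (u i2)) (tail_rV (u i0))
  else det2 (tail_rV (u i0)) (tail_rV (u i1)).
have d0 i : d i != 0.
  by rewrite /d; do 2?case: ifP => _; apply: uI.
(* k i completes the square *)
have [k kP] : exists k : 'I_3 -> C, forall i, exists b : C,
    m (d i *: u i - k i *: e) (d i *: u i - k i *: e) = b *: e.
  suff /choice[k kP] : forall i, exists k, exists b : C,
      m (d i *: u i - k *: e) (d i *: u i - k *: e) = b *: e by exists k.
  move=> i; have [a [b E]] := quad i.
  exists (2^-1 * (d i * a)), (d i ^+ 2 * b + (2^-1 * (d i * a)) ^+ 2).
  rewrite !(mDl, alg_mulDr, alg_mulNl, alg_mulNr, mZl, alg_mulZr) E !m1 !alg_mulr1.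
  by apply/rowP => l; rewrite !mxE; field.
have /choice[b bP] := kP.
pose s i := d i *: u i - k i *: e.
have tails i : tail_rV (s i) = d i *: tail_rV (u i).
  by rewrite linearB linearZ /= tail_rV_evec subr0.
have sum0 : tail_rV (\sum_i s i) = 0.
  rewrite linear_sum /= (eq_bigr _ (fun i _ => tails i)) !big_ord_recl big_ord0 addr0.
  rewrite -/i0 -/i1 -/i2 /d /=; rewrite /det2.
  move: (tail_rV (u i0)) (tail_rV (u i1)) (tail_rV (u i2)) => w0 w1 w2.
  apply/rowP => l; rewrite !mxE.
  have [->|->] : l = ord0 \/ l = ord_max.
  - by case: l => [[|[|?]]] //= ?; [left|right]; apply/val_inj.
  - by ring.
  - by ring.
apply: (frame_of_square_roots _ (b := b) (s := s) _ (tail_rV_eq0 sum0)).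
- by exists v0.
- exact: bP.
- move=> i j ij; rewrite !tails.
  have -> : det2 (d i *: tail_rV (u i)) (d j *: tail_rV (u j)) =
    d i * d j * det2 (tail_rV (u i)) (tail_rV (u j)) by rewrite /det2 !mxE; ring.
  by rewrite !mulf_neq0 ?uI.
Qed.

End TernaryAlgebra.

(** * The characteristic cubic of a potential *)

Section FlatAlgebra.
Context {R : realType} {M : topologicalType} {n : nat} {A : set (chart R M n)}
  {X : frobenius_data R M n} (frobX : frobenius_manifold X A).
Local Notation C := (CC R).
Context {a : chart R M n} (Aa : A a) {p : M} (pa : dom a p).

Lemma prodvDl (u v w : 'rV[C]_n) : prodv X a p (u + v) w = prodv X a p u w + prodv X a p v w.
Proof.
apply/rowP => k; rewrite !mxE -big_split; apply: eq_bigr => i _ /=.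
by rewrite -big_split; apply: eq_bigr => j _ /=; rewrite !mxE !mulrDl.
Qed.

Lemma prodvZl (k : C) (u v : 'rV[C]_n) : prodv X a p (k *: u) v = k *: prodv X a p u v.
Proof.
apply/rowP => l; rewrite !mxE mulr_sumr; apply: eq_bigr => i _ /=.
by rewrite mulr_sumr; apply: eq_bigr => j _ /=; rewrite !mxE !mulrA.
Qed.

Lemma prodv_evec i j : prodv X a p (evec i) (evec j) = \row_k fcst X a p i j k.
Proof.
apply/rowP => k; rewrite !mxE (bigD1 i) //= [X in _ + X]big1 ?addr0 => [|i' ii'].
  rewrite (bigD1 j) //= big1 ?addr0 => [|j' jj']; first by rewrite !mxE !eqxx !mul1r.
  by rewrite !mxE eqxx (negbTE jj') mulr0 mul0r.
by apply: big1 => j' _; rewrite !mxE eqxx (negbTE ii') !mul0r.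
Qed.

Lemma inner_evec (u : 'rV[C]_n) k : inner X a p u (evec k) = \sum_l u ord0 l * fmet X a p l k.
Proof.
rewrite /inner mxE (bigD1 k) //= big1 ?addr0 => [|j jk].
  by rewrite !mxE !eqxx mulr1.
by rewrite !mxE eqxx (negbTE jk) mulr0.
Qed.

Lemma inner_evec2 i j : inner X a p (evec i) (evec j) = fmet X a p i j.
Proof.
rewrite inner_evec (bigD1 i) //= big1 ?addr0 => [|l li]; first by rewrite !mxE !eqxx mul1r.
by rewrite !mxE eqxx (negbTE li) mul0r.
Qed.

Lemma fmet_sym i j : fmet X a p i j = fmet X a p j i.
Proof. by rewrite -!inner_evec2 (frob_met_sym frobX Aa pa). Qed.

(* P i j k stands for the third derivatives of the potential *)
Context (P : 'I_n -> 'I_n -> 'I_n -> C)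
  (PE : forall i j k, fcst X a p i j k = \sum_l invmx (fmet X a p) k l * P l i j).

Lemma inner_prodv_evec i j k :
  inner X a p (prodv X a p (evec i) (evec j)) (evec k) = P k i j.
Proof.
have um := frob_met_nondeg frobX Aa pa.
pose w := \col_l P l i j.
have E : w = fmet X a p *m (\col_l fcst X a p i j l).
  rewrite (_ : (\col_l fcst X a p i j l) = invmx (fmet X a p) *m w); first by rewrite mulKVmx.
  by apply/colP => l; rewrite !mxE PE; apply: eq_bigr => l' _; rewrite !mxE.
rewrite inner_evec prodv_evec.
transitivity (w k ord0); last by rewrite mxE.
rewrite E mxE; apply: eq_bigr => l _; rewrite !mxE mulrC; congr (_ * _).
exact: fmet_sym.
Qed.

(** Commutativity of the multiplication. *)
Lemma potential_swap i j k : P i j k = P i k j.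
Proof. by rewrite -!inner_prodv_evec (frob_prodC frobX Aa pa). Qed.

(** Invariance of the inner product: <u . v, w> = <u, v . w>. *)
Lemma potential_rot i j k : P i j k = P j k i.
Proof.
by rewrite -!inner_prodv_evec (frob_met_prod frobX Aa pa (evec j)) (frob_met_sym frobX Aa pa (evec j)).
Qed.

End FlatAlgebra.

Section PotentialDerivatives.
Context {R : realType}.
Local Notation C := (CC R).
Local Notation V := 'rV[C]_3.
Local Notation x := (lift ord0 ord0 : 'I_3).
Local Notation y := (lift ord0 ord_max : 'I_3).

(** A function that is cubic along a line is differentiated by expanding it there;
this reduces the derivatives of polynomials to ring identities. *)
Lemma is_derive_expansion {W : normedModType C} (g : W -> C) q w (d r0 r1 : C) :
  (forall h, g (h *: w + q) = g q + h * (d + h * (r0 + h * r1))) -> is_derive q w g d.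
Proof.
move=> H.
have c0 : (fun h : C => d + h * (r0 + h * r1)) @ (0 : C)^' --> d.
  have ch : (fun h : C => h) @ (0 : C)^' --> (0 : C) by apply: cvg_within.
  have c1 : (fun h : C => h * r1) @ (0 : C)^' --> 0 * r1.
    exact: (cvgM ch (cvg_cst r1)).
  have c2 : (fun h : C => r0 + h * r1) @ (0 : C)^' --> r0 + 0 * r1.
    exact: (cvgD (cvg_cst r0) c1).
  have c3 : (fun h : C => h * (r0 + h * r1)) @ (0 : C)^' --> 0 * (r0 + 0 * r1).
    exact: (cvgM ch c2).
  have := cvgD (cvg_cst d) c3.
  by rewrite mul0r addr0; apply.
have c : (fun h : C => h^-1 *: ((g \o shift q) (h *: w) - g q)) @ (0 : C)^' --> d.
  apply: (cvg_trans _ c0); apply: near_eq_cvg; near=> h.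
  have h0 : h != 0 by near: h; exact: nbhs_dnbhs_neq.
  by rewrite /= H addrAC subrr add0r -[RHS]/(_ * _) mulKf.
by split; [apply/cvg_ex; exists d|exact: cvg_lim c].
Unshelve. all: by end_near. Qed.

Definition polynomial_part (c : potential_form) (q : V) : C :=
  match c with
  | FormI => 2^-1 * q ord0 ord0 ^+ 2 * q ord0 y + 2^-1 * q ord0 ord0 * q ord0 x ^+ 2
  | FormII => 6^-1 * q ord0 ord0 ^+ 3 + q ord0 ord0 * q ord0 x * q ord0 y
  end.

Lemma potential_split c f q : potential_of c f q = polynomial_part c q + f (xy q).
Proof. by case: c; rewrite /= !mxE. Qed.

(** The symmetric trilinear form whose value at (q, q, q) is
6 * polynomial_part c q, i.e. the third derivative of the polynomial part. *)
Definition polar (c : potential_form) (u v w : V) : C :=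
  match c with
  | FormI => u ord0 ord0 * v ord0 ord0 * w ord0 y + u ord0 ord0 * v ord0 y * w ord0 ord0
     + u ord0 y * v ord0 ord0 * w ord0 ord0
     + u ord0 ord0 * v ord0 x * w ord0 x + u ord0 x * v ord0 ord0 * w ord0 x
     + u ord0 x * v ord0 x * w ord0 ord0
  | FormII => u ord0 ord0 * v ord0 ord0 * w ord0 ord0
     + u ord0 ord0 * v ord0 x * w ord0 y + u ord0 ord0 * v ord0 y * w ord0 x
     + u ord0 x * v ord0 ord0 * w ord0 y + u ord0 y * v ord0 ord0 * w ord0 x
     + u ord0 x * v ord0 y * w ord0 ord0 + u ord0 y * v ord0 x * w ord0 ord0
  end.

Lemma derive_polar1 c (u v q w : V) :
  is_derive q w (fun q => polar c u v q) (polar c u v w).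
Proof.
apply: (@is_derive_expansion _ _ _ _ _ 0 0) => h.
by case: c; rewrite /= !mxE; ring.
Qed.

Lemma derive_polar2 c (u q w : V) :
  is_derive q w (fun q => 2^-1 * polar c u q q) (polar c u w q).
Proof.
apply: (@is_derive_expansion _ _ _ _ _ (2^-1 * polar c u w w) 0) => h.
by case: c; rewrite /= !mxE; field.
Qed.

Lemma derive_polynomial_part c (q w : V) :
  is_derive q w (polynomial_part c) (2^-1 * polar c w q q).
Proof.
apply: (@is_derive_expansion _ _ _ _ _ (2^-1 * polar c w w q) (6^-1 * polar c w w w)) => h.
by case: c; rewrite /= !mxE; field.
Qed.

Lemma differentiable_xy (g : 'rV[C]_2 -> C) (q : V) :
  differentiable g (xy q) -> differentiable (g \o xy) q.
Proof.
move=> dg; apply: (@differentiable_comp _ _ _ _ (@tail_rV R 2) g) => //.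
by apply: linear_differentiable; exact: continuous_tail_rV.
Qed.

Lemma derive_xy (g : 'rV[C]_2 -> C) (q v : V) :
  differentiable g (xy q) -> 'D_v (g \o xy) q = 'D_(xy v) g (xy q).
Proof.
move=> dg; have ct := @continuous_tail_rV R 2.
have dt : differentiable (@tail_rV R 2) q by apply: linear_differentiable.
rewrite (@derive_compE _ _ _ _ (@tail_rV R 2) g q v dt dg).
by rewrite (deriveE _ dt) (diff_lin _ ct).
Qed.

Lemma derive_add_xy (P : V -> C) (g : 'rV[C]_2 -> C) (q v : V) dP :
  is_derive q v P dP -> differentiable g (xy q) ->
  'D_v (fun q => P q + g (xy q)) q = dP + 'D_(xy v) g (xy q).
Proof.
move=> [dv <-] dg; rewrite -derive_xy //.
exact: (deriveD dv (diff_derivable (differentiable_xy dg))).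
Qed.

Lemma derive3_potential c (U : set V) (F : V -> C) f u v w q :
  open U -> holomorphic (xy @` U) f -> (forall q, U q -> F q = potential_of c f q) ->
  U q ->
  'D_u (fun q => 'D_v (fun q => 'D_w F q) q) q =
  polar c w v u + 'D_(xy u) (fun z => 'D_(xy v) (fun z => 'D_(xy w) f z) z) (xy q).
Proof.
move=> oU hf FE Uq.
have near_U p : U p -> \forall r \near p, U r by move=> Up; apply: open_nbhs_nbhs.
have im p : U p -> (xy @` U) (xy p) by move=> Up; exists p.
have D1 p : U p -> 'D_w F p = 2^-1 * polar c w p p + 'D_(xy w) f (xy p).
  move=> Up; rewrite -(derive_add_xy (derive_polynomial_part c p w)); last first.
    exact: cdiff_diff (hf 0) (im _ Up).
  apply: near_eq_derive; apply: filterS (near_U _ Up) => r Ur.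
  by rewrite FE // potential_split.
have D2 p : U p -> 'D_v (fun q => 'D_w F q) p =
    polar c w v p + 'D_(xy v) (fun z => 'D_(xy w) f z) (xy p).
  move=> Up; rewrite -(derive_add_xy (derive_polar2 c w p v)); last first.
    exact: cdiff_diff (cdiff_derive (xy w) (hf 1)) (im _ Up).
  by apply: near_eq_derive; apply: filterS (near_U _ Up) => r Ur; exact: D1.
rewrite -(derive_add_xy (derive_polar1 c w v q u)); last first.
  exact: cdiff_diff (cdiff_derive (xy v) (cdiff_derive (xy w) (hf 2))) (im _ Uq).
by apply: near_eq_derive; apply: filterS (near_U _ Uq) => r Ur; exact: D2.
Qed.

End PotentialDerivatives.

Section CharacteristicCubic.
Context {R : realType}.
Local Notation C := (CC R).
Local Notation x := (lift ord0 ord0 : 'I_3).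
Local Notation y := (lift ord0 ord_max : 'I_3).

Lemma ord3P (P : 'I_3 -> Prop) : P ord0 -> P x -> P y -> forall i, P i.
Proof.
move=> P0 Px Py [[|[|[|?]]] H] //.
- by rewrite (_ : Ordinal H = ord0) //; apply/val_inj.
- by rewrite (_ : Ordinal H = x) //; apply/val_inj.
- by rewrite (_ : Ordinal H = y) //; apply/val_inj.
Qed.

Lemma sum_ord3 (W : nmodType) (f : 'I_3 -> W) : \sum_i f i = f ord0 + f x + f y.
Proof.
rewrite !big_ord_recl big_ord0 addr0 addrA.
by rewrite (_ : lift ord0 (lift ord0 ord0) = y) //; apply/val_inj.
Qed.

Lemma xy_evec_lift (j : 'I_2) : xy (evec (lift ord0 j) : 'rV[C]_3) = evec j.
Proof. by apply/rowP => k; rewrite !mxE !eqxx /= (inj_eq lift_inj). Qed.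

Lemma xy_evec0 : xy (evec ord0 : 'rV[C]_3) = 0.
Proof. by apply/rowP => k; rewrite !mxE. Qed.

Lemma evec3_sum (v : 'rV[C]_3) :
  v = v ord0 ord0 *: evec ord0 + v ord0 x *: evec x + v ord0 y *: evec y.
Proof. by rewrite [LHS]row_sum_delta sum_ord3. Qed.

Lemma char_cubic_scale c (f : 'rV[C]_2 -> C) z (k : C) v :
  char_cubic c f z (k *: v) = k ^+ 3 * char_cubic c f z v.
Proof. by case: c; rewrite /= !mxE; ring. Qed.

(** In the form II the associativity equation prevents the four coefficients from
vanishing together. *)
Lemma char_cubic_neq0 c (f : 'rV[C]_2 -> C) z : associativity_equation c f z ->
  exists v, char_cubic c f z v != 0.
Proof.
case: c => /= [_|E].
  exists (evec ord0); rewrite !mxE /=.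
  by rewrite (_ : _ - _ = 1) ?oner_neq0 //; ring.
apply: contrapT => N.
(* vanishing at (1, 0), (0, 1), (1, 1) and (1, -1) makes all coefficients zero *)
have H v : char_cubic FormII f z v = 0.
  by apply/eqP/negPn/negP => h; apply: N; exists v.
pose v (s t : C) : 'rV[C]_2 := \row_j (if j == ord0 then s else t).
have := H (v 1 0); have := H (v 0 1); have := H (v 1 1); have := H (v 1 (-1)).
rewrite /= !mxE /= => h1 h2 h3 h4.
have f1 : fxxx f z = 0 by rewrite -h4; ring.
have f4 : fyyy f z = 0.
  by apply/eqP; rewrite -oppr_eq0; apply/eqP; rewrite -h3; ring.
have f2 : fxxy f z - fxyy f z = 0 by rewrite -h2 f1 f4; ring.
have f3 : - fxxy f z - fxyy f z = 0 by rewrite -h1 f1 f4; ring.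
have f23 : fxyy f z = 0.
  transitivity (- 2^-1 * ((fxxy f z - fxyy f z) + (- fxxy f z - fxyy f z))).
    by field.
  by rewrite f2 f3 addr0 mulr0.
move: E; rewrite f1 f23 !(mul0r, mulr0) subrr => /eqP.
by rewrite eq_sym oner_eq0.
Qed.

Context {M : topologicalType} {A : set (chart R M 3)}
  {X : frobenius_data R M 3} (frobX : frobenius_manifold X A).
Context {a : chart R M 3} (Aa : A a).
Context {c : potential_form} {F : 'rV[C]_3 -> C} {f : 'rV[C]_2 -> C}
  (potF : flat_potential X a F) (holf : holomorphic (xy @` img a) f)
  (formF : forall q, img a q -> F q = potential_of c f q).
Context {p : M} (pa : dom a p).
Local Notation q := (crd a p).

Lemma pd3_potential i j k : pd3 i j k F q = polar c (evec k) (evec j) (evec i)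
  + 'D_(xy (evec i)) (fun z => 'D_(xy (evec j)) (fun z => 'D_(xy (evec k)) f z) z) (xy q).
Proof.
have oa : open (img a) by have [] := mfd_chart (frob_mfd frobX) Aa.
have Uq : img a q by exists p.
exact: (@derive3_potential R c (img a) F f (evec i) (evec j) (evec k) q oa holf formF Uq).
Qed.

Lemma fmetE i j : fmet X a p i j = polar c (evec j) (evec i) (evec ord0).
Proof.
have [_ [eta etaP] _ _ _] := potF.
by have [-> ->] := etaP _ pa; rewrite pd3_potential xy_evec0 derive0 addr0.
Qed.

(** The Gram matrix of the flat coordinates is the matrix of an involutive
permutation of the three coordinates. *)
Lemma invmx_fmet : invmx (fmet X a p) = fmet X a p.
Proof.
have um := frob_met_nondeg frobX Aa pa.
suff E : fmet X a p *m fmet X a p = 1%:M.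
  by rewrite -[LHS]mulmx1 -E mulKmx.
apply/matrixP => i j; rewrite !mxE sum_ord3 !fmetE; move: i j.
by elim/ord3P; elim/ord3P; case: c; rewrite /= !mxE /=; ring.
Qed.

(** The horizontal part of v . v only involves the products of d_x and d_y, whose
components are third derivatives of f or constants; the t-component of v
contributes a multiple of v and of e, which the determinant does not see. *)
Lemma square_cubic_prodv v : char_cubic c f (xy q) (xy v) = square_cubic (prodv X a p) v.
Proof.
have [_ _ fcE foneE _] := potF.
pose P l i j := pd3 l i j F q.
have PE i j k : fcst X a p i j k = \sum_l invmx (fmet X a p) k l * P l i j by apply: fcE.
have Pswap := potential_swap frobX Aa pa PE.
have Prot := potential_rot frobX Aa pa PE.
have etaE i j : P ord0 i j = polar c (evec j) (evec i) (evec ord0).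
  by rewrite /P pd3_potential xy_evec0 derive0 addr0.
have PfE (i j k : 'I_2) : P (lift ord0 i) (lift ord0 j) (lift ord0 k) = pd3 i j k f (xy q).
  rewrite /P pd3_potential !xy_evec_lift.
  rewrite [X in X + _](_ : _ = 0) ?add0r //.
  by case: c; rewrite /= !mxE /=; ring.
have one : fone X a p = evec ord0 by apply: foneE.
have m1 w : prodv X a p (evec ord0) w = w by rewrite -one (frob_prod1 frobX Aa pa).
have mC := frob_prodC frobX Aa pa.
set m := prodv X a p.
have fce i j k : m (evec i) (evec j) ord0 k = \sum_l polar c (evec l) (evec k) (evec ord0) * P l i j.
  rewrite /m prodv_evec mxE PE invmx_fmet; apply: eq_bigr => l _.
  by rewrite fmetE.
have E : m v v = v ord0 ord0 *: (2 *: v - v ord0 ord0 *: evec ord0)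
   + (v ord0 x ^+ 2 *: m (evec x) (evec x) + (2 * v ord0 x * v ord0 y) *: m (evec x) (evec y)
      + v ord0 y ^+ 2 *: m (evec y) (evec y)).
  have := square_expand (@prodvDl _ _ _ X a p) (@prodvZl _ _ _ X a p) mC m1
    (v ord0 ord0) (v ord0 x) (v ord0 y) (evec x) (evec y).
  by rewrite /= -evec3_sum.
rewrite /square_cubic E; set w := (X in _ *: _ + X).
have -> : det2 (tail_rV v) (tail_rV (v ord0 ord0 *: (2 *: v - v ord0 ord0 *: evec ord0) + w)) =
    v ord0 x * w ord0 y - v ord0 y * w ord0 x.
  by rewrite /det2 !mxE /=; ring.
have comb (u1 u2 u3 : 'rV[C]_3) k1 k2 k3 k : (k1 *: u1 + k2 *: u2 + k3 *: u3) ord0 k =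
    k1 * u1 ord0 k + k2 * u2 ord0 k + k3 * u3 ord0 k by rewrite !mxE.
have vx : xy v ord0 ord0 = v ord0 x by rewrite mxE.
have vy : xy v ord0 ord_max = v ord0 y by rewrite mxE.
have -> : char_cubic c f (xy q) (xy v) = match c with
  | FormI => v ord0 x ^+ 3 - P x x x * v ord0 x ^+ 2 * v ord0 y
      - 2 * P x x y * v ord0 x * v ord0 y ^+ 2 - P x y y * v ord0 y ^+ 3
  | FormII => P x x x * v ord0 x ^+ 3 + P x x y * v ord0 x ^+ 2 * v ord0 y
      - P x y y * v ord0 x * v ord0 y ^+ 2 - P y y y * v ord0 y ^+ 3
  end by rewrite !PfE -vx -vy; case: (c).
clear PE fcE; clearbody m P.
rewrite /w !comb !fce !sum_ord3 !etaE (Prot y x x) (Prot y x y).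
move: (P x x x) (P x x y) (P x y y) (P y y y) (v ord0 x) (v ord0 y).
clear; case: c => /= P1 P2 P3 P4 v1 v2.
  by rewrite !mxE /=; ring.
by rewrite !mxE /=; ring.
Qed.

End CharacteristicCubic.

(** * Charts, curves and surfaces *)

Section Charts.
Context {R : realType} {M : topologicalType} {n : nat} {A : set (chart R M n)}
  (mfdA : complex_manifold A).
Local Notation C := (CC R).
Implicit Types (a b : chart R M n) (p : M).

Lemma crdK a p : A a -> dom a p -> pt a (crd a p) = p.
Proof. by move=> Aa; have [_ _ + _ _] := mfd_chart mfdA Aa; apply. Qed.

Lemma ptK a z : A a -> img a z -> crd a (pt a z) = z.
Proof. by move=> Aa [p pa <-]; rewrite crdK. Qed.

Lemma dom_pt a z : A a -> img a z -> dom a (pt a z).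
Proof. by move=> Aa [p pa <-]; rewrite crdK. Qed.

Lemma continuous_crd a p : A a -> dom a p -> {for p, continuous (crd a)}.
Proof. by move=> Aa; have [_ _ _ + _] := mfd_chart mfdA Aa; apply. Qed.

Lemma continuous_pt a z : A a -> img a z -> {for z, continuous (pt a)}.
Proof. by move=> Aa; have [_ _ _ _] := mfd_chart mfdA Aa; apply. Qed.

Lemma open_dom a : A a -> open (dom a).
Proof. by move=> Aa; have [+ _ _ _ _] := mfd_chart mfdA Aa. Qed.

Lemma open_img a : A a -> open (img a).
Proof. by move=> Aa; have [_ + _ _ _] := mfd_chart mfdA Aa. Qed.

Lemma crd_image a (O : set M) : A a ->
  crd a @` (dom a `&` O) = img a `&` (pt a @^-1` O).
Proof.
move=> Aa; apply/seteqP; split=> [_ [p [pa pO] <-]|_ [[p pa <-]]].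
  by split; [exists p|rewrite /= crdK].
by rewrite /= crdK // => pO; exists p.
Qed.

Lemma open_crd_image a (O : set M) : A a -> open O -> open (crd a @` (dom a `&` O)).
Proof.
move=> Aa oO; rewrite crd_image // openE => z [iz Oz].
apply: filterI; first exact: open_nbhs_nbhs (conj (open_img Aa) iz).
by apply: (continuous_pt Aa iz); apply: open_nbhs_nbhs.
Qed.

Lemma open_preimage_in {T T' : topologicalType} (D : set T) (O : set T') (h : T -> T') :
  open D -> open O -> (forall s, D s -> {for s, continuous h}) -> open (D `&` h @^-1` O).
Proof.
move=> oD oO ch; rewrite openE => s [Ds Os].
apply: filterI; first exact: open_nbhs_nbhs.
by apply: (ch s Ds); apply: open_nbhs_nbhs.
Qed.

Lemma derive_transition a b p (v : 'rV[C]_n) : A a -> A b -> dom a p -> dom b p ->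
  'D_v (crd b \o pt a) (crd a p) = v *m jac a b p.
Proof.
move=> Aa Ab pa pb.
have dT : differentiable (crd b \o pt a) (crd a p).
  by apply: cdiff_diff (mfd_transition mfdA Aa Ab 0) _; exists p.
apply/rowP => j; rewrite (derive_coord _ _ dT) derive_pdE; last first.
  exact: (@differentiable_comp _ _ _ _ (crd b \o pt a) (@rV_coord R n j) _ dT
     (linear_differentiable _ (@continuous_coord R n j))).
by rewrite !mxE; apply: eq_bigr => i _; rewrite !mxE.
Qed.

Lemma derive_curve_transition a b (D : set C) (h : C -> M) s :
  A a -> A b -> open D -> holomorphic_to A D h -> D s -> dom a (h s) -> dom b (h s) ->
  derive1 (crd b \o h) s = derive1 (crd a \o h) s *m jac a b (h s).
Proof.
move=> Aa Ab oD [ch hh] Ds sa sb.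
have dh : differentiable (crd a \o h) s by apply: cdiff_diff (hh a Aa 0) _.
have dT : differentiable (crd b \o pt a) ((crd a \o h) s).
  by apply: cdiff_diff (mfd_transition mfdA Aa Ab 0) _; exists (h s).
rewrite !derive1E -(derive_transition _ Aa Ab sa sb) -(derive_compE _ dh dT).
apply: near_eq_derive.
have : \forall r \near s, dom a (h r).
  by apply: (ch s Ds); apply: open_nbhs_nbhs; split => //; exact: open_dom.
by apply: filterS => r ra; rewrite /= crdK.
Qed.

Lemma holomorphic_to_comp {m} (V : set 'rV[C]_m) (Psi : 'rV[C]_m -> M)
    {W : normedModType C} (D : set W) (h : W -> 'rV[C]_m) :
  open V -> open D -> holomorphic_to A V Psi -> holomorphic D h ->
  (forall s, D s -> V (h s)) -> holomorphic_to A D (Psi \o h).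
Proof.
move=> oV oD [cP hP] hh DV.
have cPh s : D s -> {for s, continuous (Psi \o h)}.
  move=> Ds; apply: continuous_comp; last exact/cP/DV.
  by apply: differentiable_continuous; apply: cdiff_diff (hh 0) Ds.
split=> // b Ab k.
apply: (@cdiff_comp _ _ _ _ _ _ (V `&` Psi @^-1` dom b) h (crd b \o Psi)).
- exact: open_preimage_in oD (open_dom Ab) cPh.
- exact: open_preimage_in oV (open_dom Ab) cP.
- by move=> s [Ds sb]; split=> //; exact: DV.
- by apply: cdiff_sub (hh k) => s [].
- exact: hP.
Qed.

Lemma holomorphic_to_pt a {W : normedModType C} (D : set W) (h : W -> 'rV[C]_n) :
  A a -> open D -> holomorphic D h -> (forall s, D s -> img a (h s)) ->
  holomorphic_to A D (pt a \o h).
Proof.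
move=> Aa oD hh Di; apply: (holomorphic_to_comp (open_img Aa) oD _ hh Di).
split=> [z|b Ab k]; first exact: continuous_pt.
by apply: cdiff_sub (mfd_transition mfdA Aa Ab k); rewrite crd_image.
Qed.

End Charts.

Section Surfaces.
Context {R : realType} {M : topologicalType} {n : nat} {A : set (chart R M n)}
  (mfdA : complex_manifold A).
Local Notation C := (CC R).
Implicit Types (a b : chart R M n) (p : M).

Lemma local_equation_diff (S : set M) p (O : set M) g a :
  A a -> dom a p -> local_equation A S p O g -> differentiable (g \o pt a) (crd a p).
Proof.
by move=> Aa pa [_ Op hg _ _]; apply: cdiff_diff (hg a Aa 0) _; exists p.
Qed.

Lemma tangentZ (S : set M) a p (k : C) v : A a -> dom a p -> k != 0 ->
  tangent A S a p (k *: v) -> tangent A S a p v.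
Proof.
move=> Aa pa k0 [U [g [lg]]]; have dg := local_equation_diff Aa pa lg.
rewrite (deriveE _ dg) linearZ /= -(deriveE _ dg) => /eqP.
by rewrite scaler_eq0 (negbTE k0) => /eqP gv; exists U, g.
Qed.

(** An equation of S vanishes along the curve. *)
Lemma tangent_curve (S : set M) (D : set C) (h : C -> M) s b :
  hypersurface A S -> open D -> holomorphic_to A D h -> (forall r, D r -> S (h r)) ->
  A b -> D s -> dom b (h s) -> tangent A S b (h s) (derive1 (crd b \o h) s).
Proof.
move=> surfS oD [ch hh] DS Ab Ds sb; have [U [g lg]] := surfS _ (DS _ Ds).
exists U, g; split=> //; have dg := local_equation_diff Ab sb lg.
have [oU Us _ SU _] := lg.
have dh : differentiable (crd b \o h) s by apply: cdiff_diff (hh b Ab 0) _.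
rewrite derive1E -(derive_compE _ dh dg) -[RHS](derive_cst (0 : C) s (1 : C)).
apply: near_eq_derive.
have n1 : \forall r \near s, D r by apply: open_nbhs_nbhs.
have n2 : \forall r \near s, dom b (h r).
  by apply: (ch s Ds); apply: open_nbhs_nbhs; split => //; exact: open_dom mfdA _ Ab.
have n3 : \forall r \near s, U (h r).
  by apply: (ch s Ds); apply: open_nbhs_nbhs.
apply: filterS3 n1 n2 n3 => r Dr rb Ur /=; rewrite (crdK mfdA Ab rb).
have : (S `&` U) (h r) by split=> //; exact: DS.
by rewrite SU => -[].
Qed.

End Surfaces.

(** * Idempotent frames and web directions *)

Section FrobeniusCharts.
Context {R : realType} {M : topologicalType} {n : nat} {A : set (chart R M n)}
  {X : frobenius_data R M n} (frobX : frobenius_manifold X A).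
Local Notation C := (CC R).
Implicit Types (a b : chart R M n) (p : M).

Lemma jac_unit a b p : A a -> A b -> dom a p -> dom b p -> jac a b p \in unitmx.
Proof.
move=> Aa Ab pa pb; have := frob_met_nondeg frobX Aa pa.
by rewrite (frob_met_tensor frobX Aa Ab pa pb) !unitmx_mul => /andP[/andP[]].
Qed.

Lemma idempotent_frame_transfer a b p T : A a -> A b -> dom a p -> dom b p ->
  idempotent_frame X a p T -> idempotent_frame X b p (T *m jac a b p).
Proof.
move=> Aa Ab pa pb [uT mT eT]; split.
- by rewrite unitmx_mul uT jac_unit.
- move=> i j; rewrite !row_mul -(frob_cst_tensor frobX Aa Ab pa pb) mT.
  by case: ifP => _; rewrite ?mul0mx.
- have [_ oneE] := frob_one_field frobX; rewrite (oneE _ _ _ Aa Ab pa pb).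
  by rewrite eT mulmx_suml; apply: eq_bigr => i _; rewrite row_mul.
Qed.

End FrobeniusCharts.

Section Leaves.
Context {R : realType} {M : topologicalType} {A : set (chart R M 3)}
  {X : frobenius_data R M 3} (frobX : frobenius_manifold X A).
Local Notation C := (CC R).
Context {a : chart R M 3} (Aa : A a)
  {c : potential_form} {F : 'rV[C]_3 -> C} {f : 'rV[C]_2 -> C}
  (potF : flat_potential X a F) (holf : holomorphic (xy @` img a) f)
  (formF : forall q, img a q -> F q = potential_of c f q)
  (assocf : forall z, (xy @` img a) z -> associativity_equation c f z)
  {S : set M} (surfS : hypersurface A S) (transS : transverse_to_one X A S).
Implicit Types p : M.
Let mfdA := frob_mfd frobX.

Let fone_a p : dom a p -> fone X a p = evec ord0.
Proof. by have [_ _ _ + _] := potF; apply. Qed.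

Let cubicE p v : dom a p ->
  char_cubic c f (xy (crd a p)) (xy v) = square_cubic (prodv X a p) v.
Proof. by move=> pa; exact: (square_cubic_prodv frobX Aa potF holf formF pa v). Qed.

Lemma idempotent_frameE p T : dom a p ->
  idempotent_frame X a p T <-> frame (prodv X a p) T.
Proof. by move=> pa; rewrite /idempotent_frame /frame fone_a. Qed.

Lemma prodv_one p : dom a p -> forall v, prodv X a p (evec ord0) v = v.
Proof. by move=> pa v; rewrite -(fone_a pa) (frob_prod1 frobX Aa pa). Qed.

(** Transversality, as it is used: no nonzero multiple of the unity is tangent. *)
Lemma not_tangent_one p (k : C) : S p -> dom a p ->
  tangent A S a p (k *: evec ord0) -> k = 0.
Proof.
move=> Sp pa; have [//|k0] := eqVneq k 0.
move/(tangentZ Aa pa k0) => te; exfalso.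
by apply: (transS Aa pa Sp); rewrite fone_a.
Qed.

Lemma frame_char_regular p T : dom a p -> idempotent_frame X a p T ->
  char_regular c f (xy (crd a p)).
Proof.
move=> pa /(idempotent_frameE _ pa) fT; split.
  by apply: char_cubic_neq0; apply: assocf; exists (crd a p); [exists p|].
exists (fun i => xy (row i T)); split=> [i|i j ij].
  by rewrite cubicE // (frame_cubic _ fT).
exact: (frame_det2 fT ij).
Qed.

Lemma char_regular_frame p : dom a p -> char_regular c f (xy (crd a p)) ->
  exists T, idempotent_frame X a p T.
Proof.
move=> pa [[v v0] [u [uP uI]]].
have padK (w : 'rV[C]_2) : xy (pad_rV w) = w.
  by have := @tail_rV_cons_rV R 2 0 w; rewrite /cons_rV scale0r add0r.
have cub (w : 'rV[C]_2) :
    square_cubic (prodv X a p) (pad_rV w) = char_cubic c f (xy (crd a p)) w.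
  by rewrite -cubicE // padK.
have nz : exists w, square_cubic (prodv X a p) w != 0 by exists (pad_rV v); rewrite cub.
have roots i : square_cubic (prodv X a p) (pad_rV (u i)) = 0 by rewrite cub.
have [|T fT] := idempotent_frame_of_roots (@prodvDl _ _ _ X a p) (@prodvZl _ _ _ X a p)
  (frob_prodC frobX Aa pa) (frob_prodA frobX Aa pa) (prodv_one pa) nz roots.
  by move=> i j ij; rewrite -![tail_rV _]/(xy _) !padK; exact: uI.
by exists T; apply/idempotent_frameE.
Qed.

(** The projection kills e, so the projection of a e + b e_i is that of e_i up to
the factor b, and the cubic vanishes there. *)
Lemma booklet_to_char p v : S p -> dom a p -> v != 0 ->
  booklet_direction X A S a p v ->
  [/\ xy v != 0, char_regular c f (xy (crd a p)) &
      char_cubic c f (xy (crd a p)) (xy v) = 0].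
Proof.
move=> Sp pa v0 [tv [T [i [iT [al [be vE]]]]]]; split.
- apply: contra_neq v0 => /tail_rV_eq0 vt.
  by move: tv; rewrite vt => /(not_tangent_one Sp pa) ->; rewrite scale0r.
- exact: frame_char_regular iT.
- have -> : xy v = be *: xy (row i T).
    rewrite vE fone_a //.
    have -> : xy (al *: evec ord0 + be *: row i T) = tail_rV (al *: evec ord0) + tail_rV (be *: row i T).
      by rewrite -linearD.
    by rewrite tail_rV_evec add0r linearZ.
  rewrite char_cubic_scale cubicE // frame_cubic ?mulr0 //.
  exact/idempotent_frameE.
Qed.

(** A root of the cubic is the projection of some a e + b e_i, computed in the flat
chart; the frame is then carried to the chart b by the Jacobian matrix. *)
Lemma char_to_booklet p b v : A b -> dom a p -> dom b p ->
  char_regular c f (xy (crd a p)) -> char_cubic c f (xy (crd a p)) (xy v) = 0 ->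
  tangent A S b p (v *m jac a b p) -> booklet_direction X A S b p (v *m jac a b p).
Proof.
move=> Ab pa pb reg cv tv; split=> //.
have [T iT] := char_regular_frame pa reg.
have fT := (idempotent_frameE T pa).1 iT.
rewrite cubicE // in cv.
have [i [al [be vE]]] := cubic_root_frame (@prodvDl _ _ _ X a p) (@prodvZl _ _ _ X a p)
  (frob_prodC frobX Aa pa) fT cv.
exists (T *m jac a b p), i; split; first exact: (idempotent_frame_transfer frobX).
exists al, be; rewrite row_mul vE mulmxDl -!scalemxAl -(fone_a pa).
by have [_ oneE] := frob_one_field frobX; rewrite (oneE _ _ _ Aa Ab pa pb).
Qed.

End Leaves.

(** * Leaves of the two webs *)

Lemma derive1_tail_rV (R : realType) n (k : CC R -> 'rV[CC R]_n.+1) s :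
  differentiable k s -> derive1 (@tail_rV R n \o k) s = tail_rV (derive1 k s).
Proof.
by move=> dk; rewrite !derive1E; exact: (derive_linE _ (@continuous_tail_rV R n) dk).
Qed.

Section LeafCorrespondence.
Context {R : realType} {M : topologicalType} {A : set (chart R M 3)}
  {X : frobenius_data R M 3} (frobX : frobenius_manifold X A).
Local Notation C := (CC R).
Context {a : chart R M 3} (Aa : A a)
  {c : potential_form} {F : 'rV[C]_3 -> C} {f : 'rV[C]_2 -> C}
  (potF : flat_potential X a F) (holf : holomorphic (xy @` img a) f)
  (formF : forall q, img a q -> F q = potential_of c f q)
  (assocf : forall z, (xy @` img a) z -> associativity_equation c f z)
  {S : set M} (surfS : hypersurface A S) (transS : transverse_to_one X A S).
Let mfdA := frob_mfd frobX.

(** The velocity of the projected curve is the projection of the velocity. *)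
Lemma booklet_leaf_projects L : L `<=` dom a -> booklet_leaf X A S L ->
  char_leaf c (xy @` img a) f ((xy \o crd a) @` L).
Proof.
move=> La [LS [D [h [[oD cD D0 hh LE] dir]]]]; split.
  by move=> _ [r Lr <-]; exists (crd a r) => //; exists r => //; exact: La.
have Lh s : D s -> L (h s) by move=> Ds; rewrite LE; exists s.
have hola : holomorphic D (crd a \o h).
  move=> n; have [_ /(_ a Aa n)] := hh; apply: cdiff_sub => s Ds.
  by split=> //; exact/La/Lh.
exists D, (xy \o crd a \o h); split.
  split=> //; last by rewrite LE image_comp.
  by move=> n; exact: (cdiff_lin oD (@continuous_tail_rV R 2) (hola n)).
move=> s Ds; have sa := La _ (Lh _ Ds); have [v0 bv] := dir s a Ds Aa sa.
have -> : derive1 (xy \o crd a \o h) s = xy (derive1 (crd a \o h) s).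
  exact: (derive1_tail_rV (cdiff_diff (hola 0) Ds)).
exact: (booklet_to_char frobX Aa potF holf formF assocf transS (LS _ (Lh _ Ds)) sa v0 bv).
Qed.

(** Psi is a section of the projection with values in S, so that the lifted curve
has a velocity tangent to S that projects to the given one. *)
Lemma char_leaf_lifts (V : set 'rV[C]_2) (Psi : 'rV[C]_2 -> M) L :
  open V -> holomorphic_to A V Psi -> (forall z, V z -> dom a (Psi z)) ->
  (forall z, V z -> xy (crd a (Psi z)) = z) -> (forall z, V z -> S (Psi z)) ->
  L `<=` V -> char_leaf c (xy @` img a) f L -> booklet_leaf X A S (Psi @` L).
Proof.
move=> oV hP Pa PK PS LV [_ [D [h [[oD cD D0 hh LE] dir]]]].
have Vh s : D s -> V (h s) by move=> Ds; apply: LV; rewrite LE; exists s.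
have hol : holomorphic_to A D (Psi \o h) by exact: (holomorphic_to_comp mfdA oV oD hP hh Vh).
split; first by move=> _ [z Lz <-]; exact/PS/LV.
exists D, (Psi \o h); split; first by split=> //; rewrite LE image_comp.
move=> s b Ds Ab sb.
have sa : dom a ((Psi \o h) s) by exact/Pa/Vh.
have hola : differentiable (crd a \o (Psi \o h)) s.
  by have [_ /(_ a Aa 0)] := hol; move/cdiff_diff; apply; split.
have tv : xy (derive1 (crd a \o (Psi \o h)) s) = derive1 h s.
  transitivity (derive1 (xy \o (crd a \o (Psi \o h))) s).
    exact: (esym (derive1_tail_rV hola)).
  rewrite !derive1E; apply: near_eq_derive.
  have : \forall r \near s, D r by apply: open_nbhs_nbhs.
  by apply: filterS => r Dr /=; exact/PK/Vh.
have [h0 reg cv] := dir s Ds.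
have zE : xy (crd a ((Psi \o h) s)) = h s by exact/PK/Vh.
have vb := derive_curve_transition mfdA Aa Ab oD hol Ds sa sb.
split.
  rewrite vb; apply: contra_neq h0 => vJ; rewrite -tv.
  have uJ := jac_unit frobX Aa Ab sa sb.
  by rewrite -(mulmxK uJ (derive1 _ s)) vJ mul0mx; apply/rowP => j; rewrite !mxE.
rewrite vb; apply: (char_to_booklet frobX Aa potF holf formF Ab sa sb).
- by rewrite zE.
- by rewrite zE tv.
rewrite -vb; apply: (tangent_curve mfdA surfS oD hol) => // r Dr.
exact/PS/Vh.
Qed.

End LeafCorrespondence.

Theorem theorem2 (R : realType) (M : topologicalType)
  (A : set (chart R M 3)) (X : frobenius_data R M 3)
  (frobX : frobenius_manifold X A)
  (connM : connected [set: M])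
  (ssX : semisimple X A)
  (LEe : lie_one_nonzero X A)
  (a : chart R M 3) (Aa : A a)
  (c : potential_form) (F : 'rV[CC R]_3 -> CC R) (f : 'rV[CC R]_2 -> CC R)
  (potF : flat_potential X a F)
  (holf : holomorphic (xy @` img a) f)
  (formF : forall q, img a q -> F q = potential_of c f q)
  (assocf : forall z, (xy @` img a) z -> associativity_equation c f z)
  (S : set M) (surfS : hypersurface A S) (transS : transverse_to_one X A S) :
  forall p, S p -> dom a p ->
  exists (O : set M) (V : set 'rV[CC R]_2)
         (Phi : M -> 'rV[CC R]_2) (Psi : 'rV[CC R]_2 -> M),
    [/\ open O, O p, V `<=` xy @` img a,
        biholomorphism A (S `&` O) V Phi Psi &
        forall L : set M, L `<=` S `&` O ->
          (booklet_leaf X A S L <-> char_leaf c (xy @` img a) f (Phi @` L))].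
Proof.
move=> p Sp pa; have mfdA := frob_mfd frobX.
have [W [g lg]] := surfS _ Sp.
have [oW Wp hg SW _] := lg.
pose U1 := crd a @` (dom a `&` W).
have oU1 : open U1 by exact: (open_crd_image mfdA Aa oW).
have U1a z : U1 z -> img a z by move=> [r [ra _] <-]; exists r.
have onS r : dom a r -> W r -> S r <-> (g \o pt a) (crd a r) = 0.
  move=> ra Or; rewrite /= (crdK mfdA Aa ra).
  split=> [Sr|gr].
    by have : (S `&` W) r by []; rewrite SW => -[].
  by have [] : (S `&` W) r by rewrite SW.
have U1p : U1 (crd a p) by exists p.
have Gp : (g \o pt a) (crd a p) = 0 by apply/onS.
have D0 : pd ord0 (g \o pt a) (crd a p) != 0.
  apply/eqP => De; apply: (transS _ _ Aa pa Sp).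
  have [_ _ _ oneE _] := potF.
  by exists W, g; split; [exact: lg|rewrite (oneE _ pa); exact: De].
have [B [V [tau [[oB Bp BU oV htau] [BV VB Gtau tauB]]]]] :=
  implicit_function oU1 U1p (hg a Aa) Gp D0.
pose k z : 'rV[CC R]_3 := cons_rV (tau z) z.
have Vi z : V z -> img a (k z) by move=> /VB/BU/U1a.
have hk : holomorphic V k.
  by move=> n; apply: cdiff_cons_rV => //; exact: cdiff_id.
pose Psi := pt a \o k.
have hPsi : holomorphic_to A V Psi by exact: (holomorphic_to_pt mfdA Aa oV hk Vi).
pose O := dom a `&` crd a @^-1` B.
have oO : open O.
  exact: (open_preimage_in (open_dom mfdA Aa) oB (fun r ra => continuous_crd mfdA Aa ra)).
have crdPsi z : V z -> crd a (Psi z) = k z by move=> /Vi; exact: (ptK mfdA Aa).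
have xyPsi z : V z -> xy (crd a (Psi z)) = z.
  by move=> Vz; rewrite crdPsi //; exact: tail_rV_cons_rV.
have Psia z : V z -> dom a (Psi z) by move=> /Vi; exact: (dom_pt mfdA Aa).
have BO r : dom a r -> B (crd a r) -> W r.
  by move=> ra /BU[r' [ra' Wr'] E]; rewrite -(crdK mfdA Aa ra) -E (crdK mfdA Aa ra').
have PsiO z : V z -> O (Psi z).
  by move=> Vz; split; [exact: Psia|rewrite /= crdPsi //; exact: VB].
have PsiS z : V z -> S (Psi z).
  move=> Vz; apply/onS; [exact: Psia| |by rewrite crdPsi // Gtau].
  by have [ra rB] := PsiO _ Vz; exact: BO.
have PsiK r : (S `&` O) r -> Psi (xy (crd a r)) = r.
  move=> [Sr [ra rB]]; have Gr := (onS r ra (BO _ ra rB)).1 Sr.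
  rewrite /Psi /= /k -(tauB _ rB Gr).
  by rewrite -[RHS](crdK mfdA Aa ra); congr (pt a _); exact: cons_rV_tail_rV.
have hPhi : holomorphic_on A O (xy \o crd a).
  move=> b Ab n; have ob := open_crd_image mfdA Ab oO.
  apply: (cdiff_lin ob (@continuous_tail_rV R 2)).
  by apply: cdiff_sub (mfd_transition mfdA Ab Aa n) => z [r [rb [ra _]] <-]; exists r.
exists O, V, (xy \o crd a), Psi; split=> //.
- by move=> z Vz; exists (k z); [exact: Vi|exact: tail_rV_cons_rV].
- split=> //.
  + apply/seteqP; split=> [_ [r [_ [_ rB]] <-]|z Vz]; first exact: BV.
    by exists (Psi z); [split; [exact: PsiS|exact: PsiO]|exact: xyPsi].
  + by move=> r [_ Or]; exists O, (xy \o crd a).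
move=> L LSO; split.
  apply: (booklet_leaf_projects frobX Aa potF holf formF assocf transS).
  by move=> r /LSO[_ []].
move=> cL.
have -> : L = Psi @` ((xy \o crd a) @` L).
  rewrite image_comp; apply/seteqP; split=> [r Lr|_ [r Lr <-]].
    by exists r => //; exact/PsiK/LSO.
  by rewrite /= PsiK //; exact: LSO.
apply: (char_leaf_lifts frobX Aa potF holf formF surfS oV hPsi Psia xyPsi PsiS _ cL).
by move=> _ [r /LSO[_ [_ rB]] <-]; exact: BV.
Qed.
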